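(* Let $\mathfrak D$ be a residually finite Dedekind domain, let $a\in \mathfrak D$ be a nonzero element and let $\mathfrak n$ be a nonzero ideal of $\mathfrak D$. Let $\mathfrak n=\mathfrak n_0\mathfrak n_1$ be the $a$-decomposition of $\mathfrak n$ (i.e. $\langle a\rangle\subseteq \mathrm{rad}(\mathfrak n_0)$ and $\gcd(\langle a\rangle,\mathfrak n_1)=1$). Then the functional graph of the map $\Gamma_{a,\mathfrak n}:\mathfrak D/\mathfrak n\to\mathfrak D/\mathfrak n$, $x\mapsto \Psi_{\mathfrak n}(a)\cdot x$, satisfies $$\mathcal G(\Gamma_{a,\mathfrak n})\cong \bigoplus_{\mathfrak m\mid \mathfrak n_1}\frac{\varphi_{\mathfrak D}(\mathfrak m)}{\mathcal O(a,\mathfrak m)}\times \mathrm{Cyc}\left(\mathcal O(a,\mathfrak m),\, T_{\mathfrak n_0(a)}\right),$$ where $\mathfrak m$ runs over all ideals of $\mathfrak D$ dividing $\mathfrak n_1$ and $T_{\mathfrak n_0(a)}$ is the elementary tree associated with the $\nu$-series $\mathfrak n_0(a)$.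
   Context: A residually finite Dedekind domain is a Dedekind domain $\mathfrak D$ such that $\mathfrak D/\mathfrak n$ is finite for every nonzero ideal $\mathfrak n$. For ideals, $\mathfrak m\mid\mathfrak n$ means $\mathfrak n=\mathfrak m\mathfrak m'$ for some ideal $\mathfrak m'$ (equivalently $\mathfrak n\subseteq\mathfrak m$), and $\gcd(\mathfrak n,\mathfrak m)=\mathfrak n+\mathfrak m$; $\gcd=1$ means the sum is $\mathfrak D$. $\mathrm{rad}(\mathfrak n)$ is the product of the distinct prime ideals dividing $\mathfrak n$. $\Psi_{\mathfrak n}:\mathfrak D\to\mathfrak D/\mathfrak n$ is the canonical projection. The norm is $N(\mathfrak n)=|\mathfrak D/\mathfrak n|$. For a proper nonzero ideal $\mathfrak m$, $\varphi_{\mathfrak D}(\mathfrak m)$ is the number of units of $\mathfrak D/\mathfrak m$, and $\varphi_{\mathfrak D}(\mathfrak D)=1$. For $a$ with $\langle a\rangle+\mathfrak m=\mathfrak D$, $\mathcal O(a,\mathfrak m)$ is the least positive integer $i$ with $a^i-1\in\mathfrak m$. The functional graph $\mathcal G(f)$ of a map $f:X\to X$ on a finite set has vertex set $X$ and edges $x\to f(x)$. $\bigoplus$ denotes disjoint union of graphs and $k\times G$ the disjoint union of $k$ copies of $G$. $\bullet$ is the one-vertex rooted tree. For a forest $G=T_1\oplus\cdots\oplus T_k$ of rooted trees, $\langle G\rangle$ is the rooted tree whose root has exactly $k$ predecessors, the $i$-th being the root of a copy of $T_i$ (edges directed toward the root). $\mathrm{Cyc}(m,T)$ is a graph consisting of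 one directed cycle of length $m$, each vertex of which is the root of a copy of the rooted tree $T$. $\nu$-series: if $\mathfrak n_0$ is a nonzero ideal with $\langle a\rangle\subseteq\mathrm{rad}(\mathfrak n_0)$, set $\mathfrak a_1=\gcd(\mathfrak n_0,\langle a\rangle)$, $\mathfrak a_{i+1}=\gcd\big(\mathfrak n_0/(\mathfrak a_1\cdots\mathfrak a_i),\langle a\rangle\big)$, and let $d$ be the least positive integer with $\mathfrak a_1\cdots\mathfrak a_d=\mathfrak n_0$; then $\mathfrak n_0(a)=(N(\mathfrak a_1),\dots,N(\mathfrak a_d))$. Elementary tree: for a non-increasing sequence of positive integers $V=(\nu_1,\dots,\nu_d)$, define rooted trees $T^0_V=\bullet$ and, for $1\le k<d$, $T^k_V=\big\langle \nu_k\times T^{k-1}_V\oplus\bigoplus_{i=1}^{k-1}(\nu_i-\nu_{i+1})\times T^{i-1}_V\big\rangle$; then $T_V=\big\langle(\nu_d-1)\times T^{d-1}_V\oplus\bigoplus_{i=1}^{d-1}(\nu_i-\nu_{i+1})\times T^{i-1}_V\big\rangle$. *)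

(* Defs.v *)
From HB Require Import structures.
From mathcomp Require Import all_boot all_order all_algebra.
From mathcomp Require Import generic_quotient ring_quotient.
From mathcomp Require Import finmap.
From mathcomp Require Import boolp classical_sets cardinality fsbigop.

Set Implicit Arguments.
Unset Strict Implicit.
Unset Printing Implicit Defensive.

Import GRing.Theory.
Local Open Scope ring_scope.
Local Open Scope quotient_scope.

(* Not the library's [idealr], which only covers proper ideals: the unit ideal
   has to be allowed here, as a factor, as a divisor and as a modulus. *)
Definition ideal_closed (D : idomainType) (S : {pred D}) : Prop :=
  0 \in S /\ forall c, {in S &, forall u v, c * u + v \in S}.

Record ideal (D : idomainType) := Ideal {
  ideal_pred :> {pred D};
  ideal_predP : ideal_closed ideal_pred }.

HB.instance Definition _ (D : idomainType) := gen_eqMixin (ideal D).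
HB.instance Definition _ (D : idomainType) := gen_choiceMixin (ideal D).

Section IdealTheory.
Variable D : idomainType.
Implicit Types (I J : ideal D) (a x : D).

Lemma ideal_eqP I J : I =i J <-> I = J.
Proof.
split=> [eqIJ|-> //]; case: I J eqIJ => [S HS] [T HT] /= eqST.
have E : S = T by apply: funext => x; exact: eqST.
by case: T / E HT {eqST} => HT; rewrite (Prop_irrelevance HS HT).
Qed.

Lemma ideal_zmod_closed I : zmod_closed (ideal_pred I).
Proof.
have [I0 IP] := ideal_predP I; split=> // u v Iu Iv.
by rewrite addrC -mulN1r; exact: IP.
Qed.

Lemma ideal_mulr I a x : x \in I -> a * x \in I.
Proof.
by move=> Ix; have [I0 IP] := ideal_predP I; rewrite -[a * x]addr0; exact: IP.
Qed.

Lemma ideal0_closed : ideal_closed (pred1 (0 : D)).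
Proof.
split=> [|c u v]; first by rewrite inE.
by rewrite !inE => /eqP-> /eqP->; rewrite mulr0 addr0.
Qed.
Definition ideal0 : ideal D := Ideal ideal0_closed.

Lemma ideal1_closed : ideal_closed (predT : {pred D}).
Proof. by []. Qed.
Definition ideal1 : ideal D := Ideal ideal1_closed.

Lemma principal_closed a :
  ideal_closed [pred x | `[< exists c, x = c * a >]].
Proof.
split=> [|c u v]; rewrite !inE; first by exists 0; rewrite mul0r.
move=> [y ->] [z ->]; exists (c * y + z).
by rewrite mulrDl mulrA.
Qed.
Definition principal a : ideal D := Ideal (principal_closed a).

Lemma idealD_closed I J :
  ideal_closed
    [pred x | `[< exists u v, [/\ u \in I, v \in J & x = u + v] >]].
Proof.
have [I0 IP] := ideal_predP I; have [J0 JP] := ideal_predP J.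
split=> [|c x y]; rewrite !inE; first by exists 0, 0; rewrite addr0.
move=> [u [v [Iu Jv ->]]] [u' [v' [Iu' Jv' ->]]].
exists (c * u + u'), (c * v + v').
by split; [exact: IP | exact: JP | rewrite mulrDr addrACA].
Qed.
Definition idealD I J : ideal D := Ideal (idealD_closed I J).

Lemma idealM_closed I J :
  ideal_closed
    [pred x | `[< exists2 s : seq (D * D),
                    {in s, forall p, (p.1 \in I) && (p.2 \in J)} &
                    x = \sum_(p <- s) p.1 * p.2 >]].
Proof.
split=> [|c x y]; rewrite !inE; first by exists [::]; rewrite ?big_nil.
move=> [s sIJ ->] [t tIJ ->].
exists ([seq (c * p.1, p.2) | p <- s] ++ t).
  move=> p; rewrite mem_cat => /orP[/mapP[q /sIJ/andP[Iq Jq] ->]|/tIJ//].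
  by rewrite /= ideal_mulr.
rewrite big_cat big_map mulr_sumr; congr (_ + _).
by apply: eq_bigr => p _; rewrite mulrA.
Qed.
Definition idealM I J : ideal D := Ideal (idealM_closed I J).

End IdealTheory.
Arguments ideal0 {D}.
Arguments ideal1 {D}.

HB.instance Definition _ (D : idomainType) (I : ideal D) :=
  GRing.isZmodClosed.Build D (ideal_pred I) (ideal_zmod_closed I).

(* [Quotient.quot] only carries a ring structure for proper ideals; the same
   construction is extended to all ideals, D / D being the zero ring. *)
Definition idquot (D : idomainType) (n : ideal D) : Type :=
  Quotient.quot (ideal_pred n).

Section IdealQuotient.
Variables (D : idomainType) (n : ideal D).

HB.instance Definition _ := Choice.on (idquot n).
HB.instance Definition _ := GRing.Zmodule.on (idquot n).

Definition idproj (x : D) : idquot n := \pi_(Quotient.quot (ideal_pred n)) x.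

Lemma idproj_eq x y : (idproj x == idproj y) = (x - y \in n).
Proof. by rewrite (Quotient.idealrBE (ideal_pred n)). Qed.

Lemma idproj_surj (u : idquot n) : exists x, idproj x = u.
Proof. by exists (repr (u : Quotient.quot (ideal_pred n))); exact: reprK. Qed.

Lemma idprojD : {morph idproj : x y / x + y}.
Proof. by move=> x y; exact: (raddfD (\pi_(Quotient.quot (ideal_pred n)))). Qed.

Definition idquot_one : idquot n := idproj 1.
Definition idquot_mul (u v : idquot n) : idquot n :=
  idproj (repr (u : Quotient.quot (ideal_pred n)) *
          repr (v : Quotient.quot (ideal_pred n))).

Lemma idproj_mul : {morph idproj : x y / x * y >-> idquot_mul x y}.
Proof.
move=> x y; apply/eqP; rewrite idproj_eq.
set x' := repr _; set y' := repr _.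
have xx' : x - x' \in n by rewrite -idproj_eq /idproj reprK.
have yy' : y - y' \in n by rewrite -idproj_eq /idproj reprK.
have -> : x * y - x' * y' = y * (x - x') + x' * (y - y').
  by rewrite !mulrBr [y * x]mulrC [y * x']mulrC addrA subrK.
by have [_ nP] := ideal_predP n; apply: nP => //; exact: ideal_mulr.
Qed.

Fact idquot_mulA : associative idquot_mul.
Proof.
move=> u v w; have [x <-] := idproj_surj u; have [y <-] := idproj_surj v.
by have [z <-] := idproj_surj w; rewrite -!idproj_mul mulrA.
Qed.

Fact idquot_mulC : commutative idquot_mul.
Proof.
move=> u v; have [x <-] := idproj_surj u; have [y <-] := idproj_surj v.
by rewrite -!idproj_mul mulrC.
Qed.

Fact idquot_mul1 : left_id idquot_one idquot_mul.
Proof. by move=> u; have [x <-] := idproj_surj u; rewrite -idproj_mul mul1r. Qed.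

Fact idquot_mulDl : left_distributive idquot_mul +%R.
Proof.
move=> u v w; have [x <-] := idproj_surj u; have [y <-] := idproj_surj v.
by have [z <-] := idproj_surj w; rewrite -idprojD -!idproj_mul -idprojD mulrDl.
Qed.

HB.instance Definition _ := GRing.Zmodule_isComPzRing.Build (idquot n)
  idquot_mulA idquot_mulC idquot_mul1 idquot_mulDl.

Lemma idprojM : {morph idproj : x y / x * y}.
Proof. exact: idproj_mul. Qed.

Lemma idproj1 : idproj 1 = 1.
Proof. by []. Qed.

End IdealQuotient.

Definition dvd_ideal (D : idomainType) (m n : ideal D) : Prop :=
  exists m', n = idealM m m'.

Definition prime_ideal (D : idomainType) (p : ideal D) : Prop :=
  1 \notin p /\ prime_idealr_closed p.

Definition maximal_ideal (D : idomainType) (p : ideal D) : Prop :=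
  1 \notin p /\ forall J : ideal D, {subset p <= J} -> J = p \/ J = ideal1.

(* Noetherian, integrally closed in the fraction field, and of dimension at
   most one (so that fields are not excluded). *)
Record dedekind_domain (D : idomainType) : Prop := DedekindDomain {
  dedekind_noetherian : forall I : ideal D,
    exists s : seq D, I = \big[@idealD D/ideal0]_(x <- s) principal x;
  dedekind_integrally_closed : forall z : {fraction D},
    integralOver (@tofrac D) z -> exists x : D, z = tofrac x;
  dedekind_prime_maximal : forall p : ideal D,
    prime_ideal p -> p != ideal0 -> maximal_ideal p }.

Definition residually_finite (D : idomainType) : Prop :=
  forall n : ideal D, n != ideal0 -> finite_set [set: idquot n].

(* The number of elements of A; only meaningful when A is finite. *)
Definition ncard (T : choiceType) (A : set T) : nat := #|` fset_set A|.

Definition ideal_norm (D : idomainType) (n : ideal D) : nat :=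
  ncard [set: idquot n].

Definition ideal_phi (D : idomainType) (m : ideal D) : nat :=
  if m == ideal1 then 1%N
  else ncard [set u : idquot m | exists v, v * u = 1].

(* The product runs over a finite set when n is a nonzero ideal of a Dedekind
   domain. *)
Definition ideal_rad (D : idomainType) (n : ideal D) : ideal D :=
  \big[@idealM D/ideal1]_(p \in [set p | prime_ideal p /\ dvd_ideal p n]) p.

(* The ideal k with n = m * k, which is unique if m divides n <> 0 in a
   Dedekind domain; arbitrary if m does not divide n. *)
Definition ideal_div (D : idomainType) (n m : ideal D) : ideal D :=
  xget n [set k | n = idealM m k].

Definition a_decomposition (D : idomainType) (a : D) (n n0 n1 : ideal D) :=
  [/\ n = idealM n0 n1,
      {subset principal a <= ideal_rad n0} &
      idealD (principal a) n1 = ideal1].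

(* The least element of P, or 0 if P is empty. *)
Definition least (P : pred nat) : nat :=
  if pselect (exists i, P i) is left exP then ex_minn exP else 0%N.

Definition ideal_order (D : idomainType) (a : D) (m : ideal D) : nat :=
  least (fun i => (0 < i)%N && (a ^+ i - 1 \in m)).

(* [nu_prod n0 a i] is a_1 ... a_i, and [nu_ideal n0 a i] is a_(i+1). *)
Fixpoint nu_prod (D : idomainType) (n0 : ideal D) (a : D) (i : nat) : ideal D :=
  if i is j.+1 then
    idealM (nu_prod n0 a j)
           (idealD (ideal_div n0 (nu_prod n0 a j)) (principal a))
  else ideal1.

Definition nu_ideal (D : idomainType) (n0 : ideal D) (a : D) (i : nat) :=
  idealD (ideal_div n0 (nu_prod n0 a i)) (principal a).

Definition nu_series (D : idomainType) (n0 : ideal D) (a : D) : seq nat :=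
  [seq ideal_norm (nu_ideal n0 a i)
     | i <- iota 0 (least (fun d => (0 < d)%N && (nu_prod n0 a d == n0)))].

(* Finite rooted trees. A forest is a sequence of trees, so that disjoint union
   of forests is [++] and k copies of T is [nseq k T]; [Join F] is <F>. *)
Inductive rtree := Join of seq rtree.

Definition bullet : rtree := Join [::].

(* [nu V i] is the i-th term of V, counted from 1. *)
Definition nu (V : seq nat) (i : nat) : nat := nth 0%N V i.-1.

Definition lower_forest (V : seq nat) (T : nat -> rtree) (k : nat) : seq rtree :=
  \big[cat/[::]]_(1 <= i < k) nseq (nu V i - nu V i.+1) (T i.-1).

(* T^0_V, ..., T^k_V *)
Fixpoint elem_subtrees (V : seq nat) (k : nat) : seq rtree :=
  if k is j.+1 then
    let s := elem_subtrees V j in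
    rcons s (Join (nseq (nu V k) (nth bullet s j)
                   ++ lower_forest V (nth bullet s) k))
  else [:: bullet].

Definition elem_subtree (V : seq nat) (k : nat) : rtree :=
  nth bullet (elem_subtrees V k) k.

Definition elem_tree (V : seq nat) : rtree :=
  let d := size V in
  Join (nseq (nu V d - 1) (elem_subtree V d.-1)
        ++ lower_forest V (elem_subtree V) d).

Lemma elem_subtree0 V : elem_subtree V 0 = bullet.
Proof. by []. Qed.

Lemma size_elem_subtrees V k : size (elem_subtrees V k) = k.+1.
Proof. by elim: k => //= k IHk; rewrite size_rcons IHk. Qed.

Lemma nth_elem_subtrees V k i :
  (i <= k)%N -> nth bullet (elem_subtrees V k) i = elem_subtree V i.
Proof.
elim: k => [|k IHk]; first by rewrite leqn0 => /eqP->.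
rewrite leq_eqVlt => /orP[/eqP-> //|ltik].
by rewrite /= nth_rcons size_elem_subtrees ltik IHk.
Qed.

Lemma elem_subtreeS V k : (0 < k)%N ->
  elem_subtree V k =
    Join (nseq (nu V k) (elem_subtree V k.-1)
          ++ \big[cat/[::]]_(1 <= i < k)
               nseq (nu V i - nu V i.+1) (elem_subtree V i.-1)).
Proof.
case: k => // k _; rewrite {1}/elem_subtree /= nth_rcons size_elem_subtrees.
rewrite ltnn eqxx nth_elem_subtrees //; congr (Join (_ ++ _)).
apply: eq_big_nat => i /andP[_ ltik]; congr (nseq _ _).
by apply: nth_elem_subtrees; case: i ltik => // i /ltnW.
Qed.

(* Vertices of a tree are encoded by their addresses: the root is [::], and the
   root of the i-th child of the vertex p is [rcons p i]. *)
Fixpoint tree_addr (T : rtree) (p : seq nat) : bool :=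
  if p is i :: q then
    let: Join F := T in (i < size F)%N && tree_addr (nth bullet F i) q
  else true.

Record digraph := Digraph {
  vertex :> Type;
  edge : vertex -> vertex -> Prop }.

Definition graph_iso (G H : digraph) : Prop :=
  exists2 f : G -> H, bijective f &
    forall x y : G, edge x y <-> edge (f x) (f y).

Definition functional_graph (X : Type) (f : X -> X) : digraph :=
  Digraph (fun x y : X => y = f x).

Definition gsum (I : Type) (G : I -> digraph) : digraph :=
  @Digraph {i : I & G i} (fun u v => exists i (x y : G i),
    [/\ u = existT _ i x, v = existT _ i y & edge x y]).

Definition gcopies (k : nat) (G : digraph) : digraph := gsum (fun _ : 'I_k => G).

(* Vertices are pairs (position on the cycle, address in the tree); the cycle
   goes through the vertices with address [::]. *)
Definition Cyc (m : nat) (T : rtree) : digraph :=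
  @Digraph ('I_m * {p : seq nat | tree_addr T p})%type (fun x y =>
    (x.1 = y.1 /\ exists i, val x.2 = rcons (val y.2) i) \/
    [/\ val x.2 = [::], val y.2 = [::] & (y.1 = x.1.+1 %% m :> nat)%N]).

Definition Gamma (D : idomainType) (a : D) (n : ideal D) (x : idquot n) :
  idquot n := idproj n a * x.

(* Main.v *)
(** No Chinese remainder isomorphism is needed. Let f be the multiplication by
    a on D/n and I_k the image of its k-th iterate. Since |I_k| = N(n : a^k),
    every fibre of f over I_(k+1) meets I_k in N((n : a^k) + (a)) points, which
    is the term nu_(k+1) of the series of n_0 because a is coprime to n_1. The
    height of x, the largest k <= d with x in I_k, thus determines the tree
    above x. The periodic points are the x with annihilator m dividing n_1;
    those with annihilator m have period O(a, m), and there are phi(m) of them,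
    because the number of elements killed by m is N(m) in D/n as in D/m. *)
Require Import Defs.
From HB Require Import structures.
From mathcomp Require Import all_boot all_order all_algebra.
From mathcomp Require Import finmap.
From mathcomp Require Import boolp classical_sets cardinality fsbigop.

Set Implicit Arguments.
Unset Strict Implicit.
Unset Printing Implicit Defensive.
Local Open Scope ring_scope.

Import GRing.Theory.

(** The tree above y matches the elementary tree for the following reason. If y has height h, its
    fibre meets I_j in nu_(j+1) points for each j < h, so exactly nu_(j+1) - nu_(j+2) of its
    predecessors have height j when j < h - 1. For j = h - 1 nothing is subtracted if h < d; if h =
    d, one is subtracted, the predecessor on the cycle. On the ideal side everything is phrased with
    colon ideals. (n : b) is at once the annihilator of b in D/n and the quotient of n by gcd(n,
    (b)), which turns a_1 ... a_i into gcd(n_0, (a^i)). The Dedekind axioms enter through the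
    invertibility of nonzero ideals, which yields cancellation, the equivalence of divisibility with
    containment, and the multiplicativity of the norm. Residual finiteness supplies the inductions:
    the norm drops strictly when a nonzero ideal is enlarged. *)

Lemma inj_surj_bijective (A B : Type) (g : A -> B) :
  injective g -> (forall y, exists x, g x = y) -> bijective g.
Proof.
move=> gI /boolp.choice[h hK]; exists h => // x.
by apply: gI; rewrite hK.
Qed.

(** * Trees hanging from the periodic points of a map on a finite set *)

Section FunctionalGraphTree.
Local Open Scope nat_scope.
Variables (X : finType) (f : X -> X) (V : seq nat).
Let d := size V.

Definition in_image (i : nat) (x : X) : bool := [exists z, iter i f z == x].

Lemma in_imageP i x : reflect (exists z, iter i f z = x) (in_image i x).
Proof. by apply: (iffP existsP) => -[z zx]; exists z; apply/eqP. Qed.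

Lemma in_image_le i j x : i <= j -> in_image j x -> in_image i x.
Proof.
move=> ij /in_imageP[z <-]; apply/in_imageP; exists (iter (j - i) f z).
by rewrite -iterD subnKC.
Qed.

Lemma in_imageS i x : in_image i x -> in_image i.+1 (f x).
Proof. by move=> /in_imageP[z <-]; apply/in_imageP; exists z. Qed.

(* The length of the longest backward path from x, truncated at d. *)
Definition height (x : X) : nat := \max_(i < d.+1 | in_image i x) i.

Lemma height_le x : height x <= d.
Proof. by apply/bigmax_leqP => i _; rewrite -ltnS. Qed.

(** The images decrease with i, so the indices i with x in I_i form an initial segment. *)
Lemma leq_height i x : i <= d -> (i <= height x) = in_image i x.
Proof.
move=> id; apply/idP/idP => [ih|Ii]; last first.
  by rewrite /height (bigD1 (Ordinal (id : i < d.+1))) //= leq_maxl.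
have I0 : in_image (@ord0 d) x by apply/in_imageP; exists x.
apply: (in_image_le ih); rewrite /height (bigmax_eq_arg ord0) //.
by case: arg_maxnP.
Qed.

Lemma height_lt_f x : height x < d -> height x < height (f x).
Proof.
move=> hx; rewrite leq_height //; apply: in_imageS.
by rewrite -leq_height // ltnW.
Qed.

Definition preim_height (y : X) (j : nat) : seq X :=
  [seq x <- enum X | (f x == y) && (height x == j)].

(* Ordered as the subtrees of an elementary tree are. *)
Definition children (y : X) : seq X :=
  if height y is k.+1 then
    preim_height y k ++ \big[cat/[::]]_(1 <= i < k.+1) preim_height y i.-1
  else [::].

Lemma mem_preim_height y j x :
  (x \in preim_height y j) = (f x == y) && (height x == j).
Proof. by rewrite mem_filter mem_enum andbT. Qed.

Lemma mem_lower (y x : X) k :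
  (x \in \big[cat/[::]]_(1 <= i < k.+1) preim_height y i.-1) =
  (f x == y) && (height x < k).
Proof.
elim: k => [|k IHk]; first by rewrite big_geq // ltn0 andbF.
rewrite big_nat_recr //= mem_cat IHk mem_preim_height -andb_orr ltnS.
by rewrite [height x <= k]leq_eqVlt orbC.
Qed.

(** Only predecessors of height d are left out, by [height_lt_f]: these are the ones lying on the
    cycles. *)
Lemma mem_children y x :
  (x \in children y) = (f x == y) && (height x < height y).
Proof.
rewrite /children; case: (height y) => [|k]; first by rewrite ltn0 andbF.
rewrite mem_cat mem_preim_height mem_lower -andb_orr ltnS.
by rewrite [height x <= k]leq_eqVlt.
Qed.

Lemma mem_children_f x : height x < d -> x \in children (f x).
Proof. by move=> hx; rewrite mem_children eqxx height_lt_f. Qed.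

Lemma children_uniq y : uniq (children y).
Proof.
rewrite /children; case: (height y) => [//|k].
have uniqP j : uniq (preim_height y j) by rewrite filter_uniq ?enum_uniq.
rewrite cat_uniq uniqP /=; apply/andP; split.
  apply/hasPn => x; rewrite mem_lower mem_preim_height => /andP[_ hx].
  by rewrite (ltn_eqF hx) andbF.
elim: k => [|k IHk]; first by rewrite big_geq.
rewrite big_nat_recr //= cat_uniq IHk uniqP andbT /=.
apply/hasPn => x; rewrite mem_lower mem_preim_height => /andP[_ /eqP ->].
by rewrite ltnn andbF.
Qed.

Hypothesis V_gt0 : 0 < d.
(** Together with the next hypothesis, which makes f a permutation of I_d, these counts are all that
    is known of f in this section. *)
Hypothesis card_fibre : forall i y, i < d -> in_image i.+1 y ->
  #|[pred x | (f x == y) && in_image i x]| = nu V i.+1.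
Hypothesis card_periodic_fibre : forall y, in_image d y ->
  #|[pred x | (f x == y) && in_image d x]| = 1.

Definition tree_above (y : X) : rtree :=
  if height y < d then elem_subtree V (height y) else elem_tree V.

(** For j < d, having height j means lying in I_j but not in I_(j+1), and these sets are nested. *)
Lemma size_preim_height y j : j < d ->
  size (preim_height y j) =
  #|[pred x | (f x == y) && in_image j x]|
  - #|[pred x | (f x == y) && in_image j.+1 x]|.
Proof.
move=> jd.
have -> : size (preim_height y j) = #|[pred x | (f x == y) && (height x == j)]|.
  by rewrite cardE /enum_mem /preim_height enumT.
rewrite -(cardID (in_image j.+1) [pred x | (f x == y) && in_image j x]).
set A := #|[predI _ & _]|; set B := #|[predD _ & _]|.
have -> : #|[pred x | (f x == y) && in_image j.+1 x]| = A.
  apply: eq_card => x; rewrite !inE; case: (f x == y) => //=.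
  rewrite -[x \in in_image _]/(in_image j.+1 x).
  apply/idP/andP => [Ix|[]//]; split=> //; exact: in_image_le Ix.
rewrite addKn; apply: eq_card => x; rewrite !inE.
rewrite -[x \in in_image _]/(in_image j.+1 x) andbCA -!leq_height ?(ltnW jd) //.
by rewrite -leqNgt andbC [RHS]andbC eqn_leq.
Qed.

Lemma size_preim_heightT y : in_image d y ->
  size (preim_height y d.-1) = nu V d - 1.
Proof.
move=> yd; rewrite size_preim_height ?prednK //.
by rewrite card_fibre ?prednK // card_periodic_fibre.
Qed.

(** Nothing is subtracted: a predecessor in I_(k+1) would put y in I_(k+2), above its height. *)
Lemma size_preim_height_top y k : height y = k.+1 -> k.+1 < d ->
  size (preim_height y k) = nu V k.+1.
Proof.
move=> hy kd; rewrite size_preim_height 1?ltnW // card_fibre 1?ltnW //; last first.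
  by rewrite -leq_height ?hy // ltnW.
rewrite [X in _ - X]eq_card0 ?subn0 // => x; rewrite !inE.
apply/negP => /andP[/eqP fx Ix].
have := in_imageS Ix; rewrite fx -leq_height // hy ltnn //.
Qed.

Lemma size_preim_height_low y i : i.+1 < height y ->
  size (preim_height y i) = nu V i.+1 - nu V i.+2.
Proof.
move=> hi; have hd := leq_trans hi (height_le y).
rewrite size_preim_height 1?ltnW // !card_fibre // -?leq_height ?(ltnW hi) //;
  by rewrite ltnW.
Qed.

Lemma map_nseq_preim (T : Type) (g : X -> T) (c : T) y j :
  (forall x, height x = j -> g x = c) ->
  map g (preim_height y j) = nseq (size (preim_height y j)) c.
Proof.
move=> gc; have : {in preim_height y j, forall x, g x = c}.
  by move=> x; rewrite mem_preim_height => /andP[_ /eqP/gc].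
elim: (preim_height y j) => //= x s IHs gs.
by rewrite gs ?mem_head // IHs // => z sz; rewrite gs // inE sz orbT.
Qed.

Lemma tree_above_height x j : height x = j -> j < d ->
  tree_above x = elem_subtree V j.
Proof. by move=> hx jd; rewrite /tree_above hx jd. Qed.

Lemma map_lower_forest y k : k < height y ->
  map tree_above (\big[cat/[::]]_(1 <= i < k.+1) preim_height y i.-1) =
  lower_forest V (elem_subtree V) k.+1.
Proof.
rewrite /lower_forest; elim: k => [|k IHk] hk; first by rewrite !big_geq.
rewrite (big_nat_recr k.+1) // [RHS](big_nat_recr k.+1) //= map_cat.
rewrite IHk 1?ltnW //; congr (_ ++ _).
have hd := leq_trans hk (height_le y).
rewrite (map_nseq_preim (c := elem_subtree V k)).
  by rewrite size_preim_height_low.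
by move=> x /tree_above_height -> //; rewrite ltnW // ltnW.
Qed.

(** Since the two lists agree in order as well, the addresses of the tree can be read as indices
    into [children]. *)
Lemma tree_above_children y :
  tree_above y = Join (map tree_above (children y)).
Proof.
rewrite /children; case hy: (height y) => [|k].
  by rewrite (tree_above_height hy).
have kd : k < d by rewrite -hy height_le.
rewrite map_cat map_lower_forest ?hy //.
rewrite (map_nseq_preim (c := elem_subtree V k)); last first.
  by move=> x /tree_above_height ->.
have [ltkd|] := boolP (k.+1 < d).
  rewrite (tree_above_height hy) // elem_subtreeS //.
  by rewrite size_preim_height_top.
rewrite -leqNgt => ledk; have dk : d = k.+1 by apply/eqP; rewrite eqn_leq ledk kd.
rewrite /tree_above hy -dk ltnn /elem_tree -/d.
rewrite -[k]/(k.+1.-1) -dk size_preim_heightT //.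
by rewrite -leq_height // hy dk.
Qed.

(* The vertex with address p in the tree above y. *)
Definition climb (y : X) (p : seq nat) : X :=
  foldl (fun z i => nth z (children z) i) y p.

Lemma climb_rcons y p i :
  climb y (rcons p i) = nth (climb y p) (children (climb y p)) i.
Proof. by rewrite /climb -cats1 foldl_cat. Qed.

Lemma tree_addr_rcons y p i :
  tree_addr (tree_above y) (rcons p i) =
  tree_addr (tree_above y) p && (i < size (children (climb y p))).
Proof.
elim: p y => [|j p IHp] y; rewrite /= tree_above_children size_map ?andbT //.
by have [ltj|//] := boolP (j < _); rewrite (nth_map y) //= IHp.
Qed.

Lemma climb_child y p i : tree_addr (tree_above y) (rcons p i) ->
  climb y (rcons p i) \in children (climb y p).
Proof.
by rewrite tree_addr_rcons climb_rcons => /andP[_ si]; exact: mem_nth.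
Qed.

Lemma f_climb y p i : tree_addr (tree_above y) (rcons p i) ->
  f (climb y (rcons p i)) = climb y p.
Proof. by move/climb_child; rewrite mem_children => /andP[/eqP]. Qed.

Lemma height_climb y p i : tree_addr (tree_above y) (rcons p i) ->
  height (climb y (rcons p i)) < d.
Proof.
move/climb_child; rewrite mem_children => /andP[_ /leq_trans]; apply.
exact: height_le.
Qed.

(** Apply f until height d is reached; the height grows strictly on the way, and the indices of the
    points met form the address. *)
Lemma climb_surj x :
  exists y p, [/\ height y = d, tree_addr (tree_above y) p & climb y p = x].
Proof.
have [n] := ubnP (d - height x); elim: n x => // n IHn x.
rewrite ltnS => hn; have [hx|] := boolP (height x < d); last first.
  rewrite -leqNgt => hx; exists x, [::]; split=> //.
  by apply/eqP; rewrite eqn_leq height_le hx.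
have [|y [p [hy Tp yp]]] := IHn (f x).
  by apply: leq_trans hn; rewrite ltn_sub2l // height_lt_f.
exists y, (rcons p (index x (children (f x)))); split=> //.
  by rewrite tree_addr_rcons Tp yp index_mem mem_children_f.
by rewrite climb_rcons yp nth_index // mem_children_f.
Qed.

(** Applying f removes the last index of an address. An empty address never meets a nonempty one,
    because vertices off the root have height below d. *)
Lemma climb_inj y y' p p' : height y = d -> height y' = d ->
    tree_addr (tree_above y) p -> tree_addr (tree_above y') p' ->
  climb y p = climb y' p' -> y = y' /\ p = p'.
Proof.
move=> hy hy'; elim/last_ind: p p' => [|p i IHp] p'.
  case/lastP: p' => [//|p' i'] _ /height_climb + e.
  by rewrite -e /climb /= hy ltnn.
case/lastP: p' => [|p' i'] Tp Tp' e.
  by have := height_climb Tp; rewrite e /climb /= hy' ltnn.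
have e' : climb y p = climb y' p' by rewrite -(f_climb Tp) -(f_climb Tp') e.
move: (Tp) (Tp'); rewrite !tree_addr_rcons => /andP[Tp1 si] /andP[Tp1' si'].
have [<- <-] := IHp _ Tp1 Tp1' e'; split=> //; congr rcons.
move: e si si'; rewrite !climb_rcons -e' => /eqP + si si'.
by rewrite nth_uniq ?children_uniq // => /eqP.
Qed.

End FunctionalGraphTree.

(** * Splitting a set of points of common period into cycles *)

Section OrbitDecomposition.
Local Open Scope nat_scope.
Variables (X : finType) (f : X -> X) (o : nat).
Hypothesis o_gt0 : 0 < o.

Definition cyclic_on (S : pred X) : Prop :=
  forall x, S x -> [/\ S (f x), iter o f x = x &
    forall i, 0 < i < o -> iter i f x <> x].

Lemma cyclic_on_iter S x i : cyclic_on S -> S x -> S (iter i f x).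
Proof. by move=> cS Sx; elim: i => //= i /cS[]. Qed.

Lemma cyclic_on_uniq S x : cyclic_on S -> S x -> uniq (traject f x o).
Proof.
move=> cS Sx; have [_ fo fi] := cS x Sx.
case: o o_gt0 fo fi => // n _ fo fi; rewrite looping_uniq.
apply/trajectP => -[i ltin e]; apply: (fi i.+1) => //.
by rewrite iterS -e -iterS.
Qed.

Lemma cyclic_on_reps S : cyclic_on S ->
  exists2 r : seq X, size r * o = #|S| &
    forall x, S x <-> exists2 y, y \in r & exists2 i, i < o & x = iter i f y.
Proof.
have [n] := ubnP #|S|; elim: n S => // n IHn S; rewrite ltnS => leSn cS.
have [x Sx|S0] := pickP S; last first.
  exists [::] => [|x]; first by rewrite (eq_card0 S0).
  by split=> [|[]//]; rewrite S0.
pose t := traject f x o; pose S' := [pred z | (z \notin t) && S z].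
have cardS : #|S| = o + #|S'|.
  rewrite -(cardID (mem t) S) [X in _ + X](@eq_card _ _ (mem S')) //.
  congr (_ + _); rewrite -[RHS](size_traject f x).
  rewrite -(card_uniqP (cyclic_on_uniq cS Sx)); apply: eq_card => z.
  rewrite !inE andbC; apply/andb_idr => /trajectP[i _ ->].
  exact: cyclic_on_iter cS Sx.
have xo : iter o f x = x by have [] := cS x Sx.
(* The complement of an orbit is stable under f, since z is recovered from f z by o - 1 further
   applications of f. *)
have tf z : S z -> f z \in t -> z \in t.
  move=> Sz /trajectP[i lti e]; have [_ zo _] := cS z Sz.
  rewrite -zo -(prednK o_gt0) iterSr e -iterD.
  have -> : iter (o.-1 + i) f x = iter ((o.-1 + i) %% o) f x.
    rewrite {1}(divn_eq (o.-1 + i) o) addnC iterD; congr iter.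
    by elim: (_ %/ _) => // k IHk; rewrite mulSn iterD IHk.
  by apply/trajectP; exists ((o.-1 + i) %% o); rewrite ?ltn_mod.
have cS' : cyclic_on S'.
  move=> z /andP[zt Sz]; have [Sfz zo zi] := cS z Sz; split=> //.
  by apply/andP; split=> //; apply: contra zt; exact: tf.
have [|r sr rP] := IHn S' _ cS'.
  by apply: leq_trans leSn; rewrite cardS -[X in X < _]add0n ltn_add2r.
exists (x :: r) => [|z]; first by rewrite mulSn sr cardS.
split=> [Sz|[y]]; last first.
  rewrite inE => /predU1P[-> [i _ ->]|yr [i lti zi]]; first exact: cyclic_on_iter.
  by have /andP[] : S' z by apply/rP; exists y => //; exists i.
have [/trajectP[i lti ->]|zt] := boolP (z \in t).
  by exists x; rewrite ?mem_head //; exists i.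
have /rP[y yr yz] : S' z by apply/andP.
by exists y => //; rewrite inE yr orbT.
Qed.

Lemma cyclic_on_param S : cyclic_on S ->
  exists rep : 'I_(#|S| %/ o) -> X,
    [/\ forall j, S (rep j),
        forall x, S x -> exists j (i : 'I_o), x = iter i f (rep j) &
        forall j j' (i i' : 'I_o),
          iter i f (rep j) = iter i' f (rep j') -> j = j' /\ i = i'].
Proof.
move=> cS; have [r sr rP] := cyclic_on_reps cS.
have szr : #|S| %/ o = size r by rewrite -sr mulnK.
pose rep (j : 'I_(#|S| %/ o)) := tnth (in_tuple r) (cast_ord szr j).
have repr j : rep j \in r by exact: mem_tnth.
have repS j : S (rep j) by apply/rP; exists (rep j) => //; exists 0.
have surj x : S x -> exists j (i : 'I_o), x = iter i f (rep j).
  move=> /rP[y yr [i lti ->]].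
  have /(tnthP (in_tuple r))[j ->] := yr.
  by exists (cast_ord (esym szr) j), (Ordinal lti); rewrite /rep cast_ordKV.
exists rep; split=> // j j' i i' e.
pose g (u : 'I_(#|S| %/ o) * 'I_o) := iter u.2 f (rep u.1).
(* Uniqueness by counting: g is onto S, and its domain has as many elements as S. *)
suff /fintype.image_injP/(_ (j, i) (j', i')) :
    #|fintype.image g predT| == #|predT : pred ('I_(#|S| %/ o) * 'I_o)|.
  by case/(_ isT isT e) => -> ->.
have -> : #|fintype.image g predT| = #|S|.
  apply: eq_card => x; apply/fintype.imageP/idP => [[u _ ->]|/surj[k [l ->]]].
    exact: cyclic_on_iter.
  by exists (k, l).
by rewrite cardT -cardE card_prod !card_ord szr sr.
Qed.

End OrbitDecomposition.

(** * From fibre counts and periods to the graph isomorphism *)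

Lemma graph_iso_sym (G H : digraph) : graph_iso G H -> graph_iso H G.
Proof.
move=> [f [g fK gK] fE]; exists g; first by exists f.
by move=> x y; rewrite -{1}[x]gK -{1}[y]gK; split => /fE.
Qed.

(** The isomorphism is built from the explicit graph to X: a position i on the j-th cycle of class m
    and an address p go to the point reached by climbing along p from the i-th iterate of the j-th
    representative. *)
Theorem functional_graph_iso (X : finType) (f : X -> X) (V : seq nat)
    (M : Type) (S : M -> pred X) (o : M -> nat) :
  (0 < size V)%N ->
  (forall i y, (i < size V)%N -> in_image f i.+1 y ->
    #|[pred x | (f x == y) && in_image f i x]| = nu V i.+1) ->
  (forall y, in_image f (size V) y ->
    #|[pred x | (f x == y) && in_image f (size V) x]| = 1%N) ->
  (forall x, in_image f (size V) x <-> exists m, S m x) ->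
  (forall m m' x, S m x -> S m' x -> m = m') ->
  (forall m, (0 < o m)%N) ->
  (forall m, cyclic_on f (o m) (S m)) ->
  graph_iso (functional_graph f)
    (gsum (fun m : M => gcopies (#|S m| %/ o m) (Cyc (o m) (elem_tree V)))).
Proof.
move=> V0 Vf Vp SP Sdisj o0 Scyc; apply: graph_iso_sym.
pose rep m := projT1 (cid (cyclic_on_param (o0 m) (Scyc m))).
have repP m : [/\ forall j, S m (rep m j),
    forall x, S m x -> exists j (i : 'I_(o m)), x = iter i f (rep m j) &
    forall j j' (i i' : 'I_(o m)),
      iter i f (rep m j) = iter i' f (rep m j') -> j = j' /\ i = i'].
  exact: projT2 (cid (cyclic_on_param (o0 m) (Scyc m))).
set d := size V in V0 Vf Vp SP.
have height_d y : height f V y = d <-> in_image f d y.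
  rewrite -(leq_height f y (leqnn d)); split=> [->|] //.
  by move=> yd; apply/eqP; rewrite eqn_leq height_le yd.
have rootS m j i : S m (iter i f (rep m j)).
  by apply: cyclic_on_iter (Scyc m) _; have [] := repP m.
have root_d m j i : height f V (iter i f (rep m j)) = d.
  by apply/height_d/SP; exists m.
have tree_d y : height f V y = d -> tree_above f V y = elem_tree V.
  by rewrite /tree_above => ->; rewrite ltnn.
set G := gsum _.
pose g (u : G) : X :=
  climb f V (iter (val (projT2 (projT2 u)).1) f (rep (projT1 u) (projT1 (projT2 u))))
    (val (projT2 (projT2 u)).2).
have gI : injective g.
  move=> [m [j [i [p Tp]]]] [m' [j' [i' [p' Tp']]]]; rewrite /g /= => e.
  have [||e1 e2] := climb_inj V0 Vf Vp (root_d m j i) (root_d m' j' i') _ _ e.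
  - by rewrite tree_d.
  - by rewrite tree_d.
  have mm : m = m' by apply: (Sdisj _ _ _ (rootS m j i)); rewrite e1.
  case: m' / mm j' i' Tp' e e1 => j' i' Tp' _.
  have [_ _ /[apply] -[<- <-]] := repP m.
  by case: p' / e2 Tp' => Tp'; rewrite (bool_irrelevance Tp Tp').
have gS x : exists u, g u = x.
  have [y [p [yd Tp <-]]] := climb_surj V0 Vf Vp x.
  have /SP[m Smy] : in_image f d y by apply/height_d.
  have [_ /(_ y Smy)[j [i e]] _] := repP m.
  have Tp' : tree_addr (elem_tree V) p by rewrite -(tree_d y).
  by exists (existT _ m (existT _ j (i, exist _ p Tp'))); rewrite /g /= -e.
have g_edge (u v : G) : edge u v -> f (g u) = g v.
  move=> [m [x [y [-> -> [j [[i p] [[i' p'] [-> ->]]]]]]]] /=.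
  rewrite /g /= => -[[<- [k pk]]|[-> -> ->]].
    rewrite pk (f_climb V0 Vf Vp) // tree_d // -pk; exact: valP p.
  rewrite /climb /= -iterS.
  have [rS _ _] := repP m; have [_ fo _] := Scyc m _ (rS j).
  have [lt|le] := ltnP i.+1 (o m); first by rewrite modn_small.
  have -> : i.+1 = o m by apply/eqP; rewrite eqn_leq le ltn_ord.
  by rewrite modnn.
(* Edges are reflected because each vertex u has an outgoing edge: its end has image f (g u), and g
   is injective. *)
have edge_total (u : G) : exists v : G, edge u v.
  case: u => m [j [i [p Tp]]]; case/lastP: p Tp => [|p k] Tp.
    have lti : ((i.+1 %% o m) < o m)%N by rewrite ltn_mod.
    exists (existT _ m (existT _ j (Ordinal lti, exist _ [::] isT))).
    exists m, (existT _ j (i, exist _ [::] Tp)),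
      (existT _ j (Ordinal lti, exist _ [::] isT)); split=> //.
    exists j, (i, exist _ [::] Tp), (Ordinal lti, exist _ [::] isT).
    by split=> //; right.
  have Tp' : tree_addr (elem_tree V) p.
    move: Tp; rewrite -(tree_d _ (root_d m j i)) (tree_addr_rcons V0 Vf Vp).
    by case/andP.
  exists (existT _ m (existT _ j (i, exist _ p Tp'))).
  exists m, (existT _ j (i, exist _ (rcons p k) Tp)), (existT _ j (i, exist _ p Tp')).
  split=> //; exists j, (i, exist _ (rcons p k) Tp), (i, exist _ p Tp').
  by split=> //; left; split=> //; exists k.
exists g; first exact: inj_surj_bijective.
move=> u v; split=> [/g_edge//|/= e].
by have [w uw] := edge_total u; rewrite (gI v w) // e (g_edge _ _ uw).
Qed.

(** * Sums, products, colons and invertibility of ideals *)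

Section IdealArithmetic.
Variable D : idomainType.
Implicit Types (I J K : ideal D) (a b x y : D).

Lemma principalP b x : reflect (exists c, x = c * b) (x \in principal b).
Proof. by rewrite inE; exact: asboolP. Qed.

Lemma idealDP I J x :
  reflect (exists u v, [/\ u \in I, v \in J & x = u + v]) (x \in idealD I J).
Proof. by rewrite inE; exact: asboolP. Qed.

Lemma idealMP I J x :
  reflect (exists2 s : seq (D * D),
             {in s, forall p, (p.1 \in I) && (p.2 \in J)} &
             x = \sum_(p <- s) p.1 * p.2) (x \in idealM I J).
Proof. by rewrite inE; exact: asboolP. Qed.

Lemma ideal_anti I J : {subset I <= J} -> {subset J <= I} -> I = J.
Proof. by move=> IJ JI; apply/ideal_eqP => x; apply/idP/idP => [/IJ|/JI]. Qed.

Lemma ideal_mull I a x : x \in I -> x * a \in I.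
Proof. by rewrite mulrC; exact: ideal_mulr. Qed.

Lemma mem_principal b : b \in principal b.
Proof. by apply/principalP; exists 1; rewrite mul1r. Qed.

Lemma principal_sub I b : {subset principal b <= I} <-> b \in I.
Proof.
split=> [|Ib x /principalP[c ->]]; first by apply; exact: mem_principal.
exact: ideal_mulr.
Qed.

Lemma idealD_subl I J : {subset I <= idealD I J}.
Proof. by move=> x Ix; apply/idealDP; exists x, 0; rewrite addr0 rpred0. Qed.

Lemma idealD_subr I J : {subset J <= idealD I J}.
Proof. by move=> x Ix; apply/idealDP; exists 0, x; rewrite add0r rpred0. Qed.

Lemma idealD_sub I J K :
  {subset I <= K} -> {subset J <= K} -> {subset idealD I J <= K}.
Proof. by move=> IK JK x /idealDP[u [v [/IK Ku /JK Kv ->]]]; exact: rpredD. Qed.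

Lemma mem_idealM I J x y : x \in I -> y \in J -> x * y \in idealM I J.
Proof.
move=> Ix Jy; apply/idealMP; exists [:: (x, y)].
  by move=> p; rewrite inE => /eqP -> /=; rewrite Ix.
by rewrite big_seq1.
Qed.

Lemma idealM_sub I J K :
  (forall x y, x \in I -> y \in J -> x * y \in K) -> {subset idealM I J <= K}.
Proof.
move=> IJK x /idealMP[s sIJ ->]; rewrite big_seq.
by apply: rpred_sum => p /sIJ/andP[Ip Jp]; exact: IJK.
Qed.

Lemma idealMC I J : idealM I J = idealM J I.
Proof.
by apply: ideal_anti; apply: idealM_sub => x y Ix Jy; rewrite mulrC mem_idealM.
Qed.

Lemma idealM_subl I J : {subset idealM I J <= I}.
Proof. by apply: idealM_sub => x y Ix _; exact: ideal_mull. Qed.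

Lemma idealM_subr I J : {subset idealM I J <= J}.
Proof. by rewrite idealMC; exact: idealM_subl. Qed.

Lemma idealMS I J K : {subset J <= K} -> {subset idealM I J <= idealM I K}.
Proof. by move=> JK; apply: idealM_sub => x y Ix /JK; exact: mem_idealM. Qed.

Lemma idealM1 I : idealM I ideal1 = I.
Proof.
apply: ideal_anti; first exact: idealM_subl.
by move=> x Ix; rewrite -[x]mulr1 mem_idealM.
Qed.

Lemma ideal1P I : 1 \in I -> I = ideal1.
Proof.
by move=> I1; apply: ideal_anti => // x _; rewrite -[x]mulr1 ideal_mulr.
Qed.

Lemma colon_closed I b : ideal_closed [pred x | x * b \in I].
Proof.
split=> [|c u v]; rewrite !inE; first by rewrite mul0r rpred0.
by move=> Iu Iv; rewrite mulrDl -mulrA rpredD // ideal_mulr.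
Qed.
(** The colon ideal (I : (b)). *)
Definition colon I b : ideal D := Ideal (colon_closed I b).

Lemma in_colon I b x : (x \in colon I b) = (x * b \in I).
Proof. by []. Qed.

Lemma sub_colon I b : {subset I <= colon I b}.
Proof. by move=> x Ix; rewrite in_colon ideal_mull. Qed.

Lemma colon_colon I a b : colon (colon I a) b = colon I (b * a).
Proof. by apply/ideal_eqP => x; rewrite !in_colon mulrA. Qed.

Lemma idealMA I J K : idealM I (idealM J K) = idealM (idealM I J) K.
Proof.
have half I' J' K' :
    {subset idealM (idealM I' J') K' <= idealM I' (idealM J' K')}.
  (* With z fixed, the claim on x * z becomes membership of x in a colon ideal, so [idealM_sub]
     applies a second time. *)
  apply: idealM_sub => x z + K'z; rewrite -in_colon; move: x.
  apply: idealM_sub => x y I'x J'y; rewrite in_colon -mulrA.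
  by rewrite mem_idealM ?mem_idealM.
apply: ideal_anti; last exact: half.
by rewrite idealMC -[idealM J K]idealMC [idealM (idealM I J) _]idealMC
   [idealM I J]idealMC; exact: half.
Qed.

Lemma idealMDr I J K : idealM I (idealD J K) = idealD (idealM I J) (idealM I K).
Proof.
apply: ideal_anti.
  apply: idealM_sub => x _ Ix /idealDP[u [v [Ju Kv ->]]]; rewrite mulrDr.
  by apply/idealDP; exists (x * u), (x * v); rewrite !mem_idealM.
by apply: idealD_sub; apply: idealMS; [exact: idealD_subl|exact: idealD_subr].
Qed.

Lemma principalM a b : idealM (principal a) (principal b) = principal (a * b).
Proof.
apply: ideal_anti; last first.
  by apply/principal_sub; rewrite mem_idealM ?mem_principal.
apply: idealM_sub => _ _ /principalP[c ->] /principalP[e ->].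
by apply/principalP; exists (c * e); rewrite mulrACA.
Qed.

Lemma mem_principalM b I x :
  x \in idealM (principal b) I -> exists2 y, y \in I & x = b * y.
Proof.
have C : ideal_closed [pred x | `[< exists2 y, y \in I & x = b * y >]].
  split=> [|c u v]; rewrite !inE; first by exists 0; rewrite ?mulr0 ?rpred0.
  move=> [y Iy ->] [z Iz ->]; exists (c * y + z).
    by rewrite rpredD // ideal_mulr.
  by rewrite mulrDr mulrCA.
suff /[apply] : {subset idealM (principal b) I <= Ideal C} by rewrite !inE.
apply: idealM_sub => _ y /principalP[c ->] Iy; rewrite !inE.
by exists (c * y); rewrite ?ideal_mulr // mulrCA mulrA.
Qed.

Lemma ideal_neq0P I : reflect (exists2 x, x != 0 & x \in I) (I != ideal0).
Proof.
apply: (iffP idP) => [|[x x0 Ix]]; last first.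
  by apply/eqP => I0; move: Ix; rewrite I0 inE (negbTE x0).
apply: contra_neqP => I0; apply: ideal_anti => x; last by rewrite inE => /eqP->; exact: rpred0.
by move=> Ix; rewrite inE; apply/negPn/negP => x0; apply: I0; exists x.
Qed.

Lemma ideal_neq0_sub I J : {subset I <= J} -> I != ideal0 -> J != ideal0.
Proof. by move=> IJ /ideal_neq0P[x x0 /IJ Jx]; apply/ideal_neq0P; exists x. Qed.

Lemma idealM_neq0l I J : idealM I J != ideal0 -> I != ideal0.
Proof. by apply: ideal_neq0_sub; exact: idealM_subl. Qed.

Lemma idealM_neq0r I J : idealM I J != ideal0 -> J != ideal0.
Proof. by apply: ideal_neq0_sub; exact: idealM_subr. Qed.

Lemma ideal1_neq0 : ideal1 != ideal0 :> ideal D.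
Proof. by apply/ideal_neq0P; exists 1; rewrite ?oner_neq0. Qed.

(* Stated without fractional ideals. *)
Definition invertible I : Prop :=
  exists J b, b != 0 /\ idealM I J = principal b.

(** Multiplying by the complementary ideal of I turns the inclusion into one between b J and b K,
    and b cancels. *)
Lemma invertible_sub I J K : invertible I ->
  {subset idealM I J <= idealM I K} -> {subset J <= K}.
Proof.
move=> [I' [b [b0 Ib]]] IJK x Jx.
have : b * x \in idealM (principal b) K.
  suff : {subset idealM (principal b) J <= idealM (principal b) K}.
    by apply; rewrite mem_idealM ?mem_principal.
  rewrite -Ib [idealM I I']idealMC -!idealMA; exact: idealMS.
by case/mem_principalM => y Ky /(mulfI b0) ->.
Qed.

Lemma invertible_inj I J K : invertible I -> idealM I J = idealM I K -> J = K.
Proof.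
by move=> Ii e; apply: ideal_anti; apply: (invertible_sub Ii); rewrite e.
Qed.

Lemma invertible_dvd I J : invertible I -> {subset J <= I} -> dvd_ideal I J.
Proof.
(* The quotient of J by I is (1/b) I' J. It lies in D because I' J is contained in I' I = (b), and
   is then the colon ideal given here. *)
move=> [I' [b [b0 Ib]]] JI; exists (colon (idealM I' J) b).
have I'Jb y : y \in idealM I' J -> exists2 x, x \in colon (idealM I' J) b & y = b * x.
  move=> y'; have : y \in principal b.
    by rewrite -Ib idealMC; apply: idealMS y'.
  by case/principalP => c e; exists c; [rewrite in_colon -e|rewrite e mulrC].
apply: (@invertible_inj (principal b)).
  by exists ideal1, b; rewrite idealM1.
rewrite idealMA [idealM _ I]idealMC -idealMA.
have -> : idealM (principal b) (colon (idealM I' J) b) = idealM I' J.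
  apply: ideal_anti => [x /mem_principalM[y]|x /I'Jb[y Iy ->]].
    by rewrite in_colon mulrC => ? ->.
  by rewrite mem_idealM ?mem_principal.
by rewrite idealMA Ib.
Qed.

End IdealArithmetic.

(** * Finite quotients and the norm *)

Section FiniteQuotient.
Variables (D : idomainType) (n : ideal D).
Hypothesis fin : finite_set [set: idquot n].

(* The finType structure needs the finiteness proof, hence an alias. *)
Definition fquot of finite_set [set: idquot n] : Type := idquot n.

Let E : seq (idquot n) := fset_set [set: idquot n].

Let memE x : x \in E.
Proof. by rewrite in_fset_set // in_setT. Qed.

HB.instance Definition _ := GRing.ComPzRing.on (fquot fin).

Fact fquot_pickleK : pcancel (fun x : fquot fin => index x E) (onth E).
Proof.
by move=> x; rewrite onthE (nth_map x) ?index_mem ?memE // nth_index ?memE.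
Qed.
HB.instance Definition _ := isCountable.Build (fquot fin) fquot_pickleK.

Fact fquot_enumP : Finite.axiom (E : seq (fquot fin)).
Proof. by move=> x; rewrite count_uniq_mem ?fset_uniq // memE. Qed.
HB.instance Definition _ := isFinite.Build (fquot fin) fquot_enumP.

Lemma ncardE (A : set (idquot n)) :
  ncard A = #|[pred x : fquot fin | x \in A]|.
Proof.
have finA : finite_set A by apply: sub_finite_set fin.
rewrite /ncard -(@card_uniqP (fquot fin) _ (fset_uniq _)).
by apply: eq_card => x; rewrite [RHS]inE; exact: in_fset_set.
Qed.

Lemma ideal_normE : ideal_norm n = #|{: fquot fin}|.
Proof.
by rewrite /ideal_norm ncardE; apply: eq_card => x; rewrite inE; exact: mem_set.
Qed.

Definition proj (x : D) : fquot fin := idproj n x.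
Definition lift_proj (u : fquot fin) : D := repr (u : Quotient.quot (ideal_pred n)).

Lemma lift_projK : cancel lift_proj proj.
Proof. by move=> u; exact: reprK. Qed.

Lemma proj_eq x y : (proj x == proj y) = (x - y \in n).
Proof. exact: idproj_eq. Qed.

Lemma projP x y : reflect (proj x = proj y) (x - y \in n).
Proof. by rewrite -proj_eq; exact: eqP. Qed.

Lemma projM x y : proj (x * y) = proj x * proj y.
Proof. exact: idprojM. Qed.

Lemma projD x y : proj (x + y) = proj x + proj y.
Proof. exact: idprojD. Qed.

Lemma proj0 : proj 0 = 0.
Proof. by apply: (addrI (proj 0)); rewrite -projD !addr0. Qed.

Lemma projB x y : proj (x - y) = proj x - proj y.
Proof. by apply: (addIr (proj y)); rewrite -projD !subrK. Qed.

Lemma proj_eq0 x : (proj x == 0) = (x \in n).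
Proof. by rewrite -proj0 proj_eq subr0. Qed.

Lemma lift_proj_proj x : x - lift_proj (proj x) \in n.
Proof. by rewrite -proj_eq lift_projK. Qed.

End FiniteQuotient.

Section IdealNorm.
Variable D : idomainType.
Hypothesis D_resfin : residually_finite D.
Implicit Types (I J K n m : ideal D).

(** Lagrange's formula for n inside J inside D, where h picks one representative in each class of
    J/n. *)
Lemma ideal_norm_index n J (n_neq0 : n != ideal0) (A : finType) (h : A -> D) :
  {subset n <= J} -> (forall z z', h z - h z' \in n -> z = z') ->
  (forall z, h z \in J) ->
  (forall x, x \in J -> exists z, x - h z \in n) ->
  ideal_norm n = (#|A| * ideal_norm J)%N.
Proof.
move=> nJ hI hJ hS.
have finn := D_resfin n_neq0.
have finJ := D_resfin (ideal_neq0_sub nJ n_neq0).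
rewrite (ideal_normE finn) (ideal_normE finJ) -card_prod; apply: esym.
pose g (u : A * fquot finJ) : fquot finn := proj finn (h u.1 + lift_proj u.2).
apply: (@bij_eq_card _ _ g); apply: inj_surj_bijective.
  move=> [z y] [z' y'] /projP /= e.
  rewrite opprD addrACA in e; have ey : y = y'.
    rewrite -[y]lift_projK -[y']lift_projK; apply/projP.
    by have := nJ _ e; rewrite rpredDl // rpredB ?hJ.
  by rewrite ey subrr addr0 in e *; rewrite (hI _ _ e).
move=> x; pose y := proj finJ (lift_proj x).
have [z xz] := hS _ (lift_proj_proj finJ (lift_proj x)).
exists (z, y); rewrite /g /= -[RHS]lift_projK; apply/eqP; rewrite eq_sym proj_eq.
by rewrite opprD addrA addrAC.
Qed.

(** Multiplication by b identifies D/(n : b) with (n + (b))/n. *)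
Lemma ideal_norm_colon n b : n != ideal0 ->
  ideal_norm n = (ideal_norm (colon n b) * ideal_norm (idealD n (principal b)))%N.
Proof.
move=> n0; have finc := D_resfin (ideal_neq0_sub (@sub_colon _ n b) n0).
rewrite (ideal_normE finc).
apply: (ideal_norm_index n0 (h := fun z : fquot finc => lift_proj z * b)).
- exact: idealD_subl.
- move=> z z'; rewrite -mulrBl -in_colon => zz'.
  by rewrite -[z]lift_projK -[z']lift_projK; apply/projP.
- by move=> z; apply: idealD_subr; apply/principalP; eexists.
- move=> x /idealDP[u [v [nu /principalP[c ->] ->]]]; exists (proj finc c).
  rewrite -addrA rpredD // -mulrBl -in_colon; exact: lift_proj_proj.
Qed.

Lemma ideal_norm_card n J (fin : finite_set [set: idquot n]) :
  n != ideal0 -> {subset n <= J} ->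
  ideal_norm n =
    (#|[pred u : fquot fin | lift_proj u \in J]| * ideal_norm J)%N.
Proof.
move=> n0 nJ; pose A := {x : fquot fin | lift_proj x \in J}.
have -> : #|[pred u : fquot fin | lift_proj u \in J]| = #|{: A}|.
  by rewrite card_sig.
apply: (ideal_norm_index n0 (h := fun z : A => lift_proj (val z))) => //.
- move=> z z' zz'; apply: val_inj; rewrite -[val z]lift_projK -[val z']lift_projK.
  exact/(projP fin).
- by move=> z; exact: (valP z).
- move=> x Jx; have Jlx : lift_proj (proj fin x) \in J.
    by rewrite -[lift_proj _](subKr x) rpredB // nJ // lift_proj_proj.
  by exists (exist _ (proj fin x) Jlx); exact: lift_proj_proj.
Qed.

Lemma ideal_norm_sub n J : n != ideal0 -> {subset n <= J} ->
  exists2 k, (0 < k)%N & ideal_norm n = (k * ideal_norm J)%N.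
Proof.
move=> n0 nJ; have fin := D_resfin n0.
eexists; last exact: (ideal_norm_card fin).
apply/card_gt0P; exists 0; rewrite inE nJ //.
by rewrite -(proj_eq0 fin) lift_projK.
Qed.

Lemma ideal_norm_gt0 n : n != ideal0 -> (0 < ideal_norm n)%N.
Proof.
by move=> n0; rewrite (ideal_normE (D_resfin n0)); apply/card_gt0P; exists 0.
Qed.

Lemma ideal_norm1 : ideal_norm (ideal1 : ideal D) = 1%N.
Proof.
have fin := D_resfin (ideal1_neq0 D); rewrite (ideal_normE fin).
apply/eqP/fintype1P; exists 0 => x; rewrite -[x]lift_projK.
by apply/eqP; rewrite proj_eq0.
Qed.

Lemma ideal_norm_eq1 n : n != ideal0 -> ideal_norm n = 1%N -> n = ideal1.
Proof.
move=> n0; rewrite (ideal_normE (D_resfin n0)) => /eqP/fintype1P[x0 xE].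
apply: ideal1P; rewrite -(proj_eq0 (D_resfin n0)).
by rewrite [proj _ _]xE eq_sym [0]xE.
Qed.

Lemma ideal_norm_lt n J : n != ideal0 -> {subset n <= J} -> n <> J ->
  (ideal_norm J < ideal_norm n)%N.
Proof.
move=> n0 nJ nneJ; have [b Jb nb] : exists2 b, b \in J & b \notin n.
  apply: contrapT => H; apply: nneJ; apply: ideal_anti => // b Jb.
  by apply/negPn/negP => nb; apply: H; exists b.
have c0 := ideal_neq0_sub (@sub_colon _ n b) n0.
have nb0 := ideal_neq0_sub (@idealD_subl _ n (principal b)) n0.
have [|k k0 e] := @ideal_norm_sub (idealD n (principal b)) J nb0.
  by apply: idealD_sub nJ _; exact/principal_sub.
have J0 := ideal_norm_gt0 (ideal_neq0_sub nJ n0).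
rewrite (ideal_norm_colon b n0) e mulnA -[X in (X < _)%N]mul1n ltn_pmul2r //.
(* As b is outside n, the ideal (n : b) misses 1, so its norm is at least 2. *)
have : (1 < ideal_norm (colon n b))%N.
  rewrite ltn_neqAle ideal_norm_gt0 // andbT eq_sym; apply/eqP.
  move/(ideal_norm_eq1 c0)/ideal_eqP/(_ 1); rewrite in_colon mul1r (negbTE nb).
  by [].
by move/leq_trans; apply; exact: leq_pmulr.
Qed.

End IdealNorm.

(** * Invertibility of nonzero ideals and multiplicativity of the norm *)

Lemma ideal_generatedP (D : idomainType) (s : seq D) (y : D) :
  y \in \big[@idealD D/ideal0]_(x <- s) principal x ->
  exists c : nat -> D, y = \sum_(i < size s) c i * s`_i.
Proof.
elim: s y => [|x s IHs] y.
  by rewrite big_nil inE => /eqP ->; exists (fun=> 0); rewrite big_ord0.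
rewrite big_cons => /idealDP[_ [v [/principalP[e ->] /IHs[c ->] ->]]].
by exists (fun i => if i is j.+1 then c j else e); rewrite big_ord_recl.
Qed.

Lemma mem_generated (D : idomainType) (s : seq D) (i : nat) : (i < size s)%N ->
  s`_i \in \big[@idealD D/ideal0]_(x <- s) principal x.
Proof.
elim: s i => [//|x s IHs] [|i] lti; rewrite big_cons.
  by apply: idealD_subl; exact: mem_principal.
by apply: idealD_subr; exact: IHs.
Qed.

Section Dedekind.
Variable D : idomainType.
Hypothesis D_dedekind : dedekind_domain D.
Hypothesis D_resfin : residually_finite D.
Implicit Types (I J K n m : ideal D) (a b x y : D).

(* [x / b] is an eigenvalue of a matrix over D, hence integral. *)
Lemma dvd_of_stable I x b : I != ideal0 -> b != 0 ->
  (forall y, y \in I -> exists2 y', y' \in I & x * y = b * y') ->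
  x \in principal b.
Proof.
move=> I0 b0 xI; have [s Is] := dedekind_noetherian D_dedekind I.
have sI (j : 'I_(size s)) : exists c : nat -> D,
    x * s`_j = b * \sum_(i < size s) c i * s`_i.
  have [|y' + ->] := xI s`_j; first by rewrite Is mem_generated.
  by rewrite Is => /ideal_generatedP[c ->]; exists c.
have [c cE] := boolp.choice sI.
(* The coefficients are transposed because eigenvectors are rows: the row of generators is one for x
   / b, and it is nonzero since I is. *)
pose C : 'M[D]_(size s) := \matrix_(i, j) c j i.
pose z : {fraction D} := tofrac x / tofrac b.
have fb0 : tofrac b != 0 by rewrite tofrac_eq0.
have [w zw] : exists w : D, z = tofrac w.
  apply: (dedekind_integrally_closed D_dedekind); exists (char_poly C).
    exact: char_poly_monic.
  rewrite map_char_poly -eigenvalue_root_char; apply/eigenvalueP.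
  exists (\row_i tofrac s`_i); last first.
    have [y y0] := ideal_neq0P _ I0; rewrite Is => /ideal_generatedP[e ye].
    apply: contra_neq y0 => s0; rewrite ye big1 // => i _.
    suff -> : s`_i = 0 by rewrite mulr0.
    by apply/eqP; rewrite -tofrac_eq0; move/rowP/(_ i): s0; rewrite !mxE => ->.
  apply/rowP => j; rewrite !mxE.
  apply: (mulfI fb0); rewrite mulrA [_ * z]mulrC divfK //.
  rewrite -tofracM cE tofracM; congr (_ * _); rewrite rmorph_sum.
  by apply: eq_bigr => i _; rewrite !mxE rmorphM mulrC.
apply/principalP; exists w; apply/eqP; rewrite -tofrac_eq tofracM -zw.
by rewrite divfK.
Qed.

Lemma ideal_maximal (P : ideal D -> Prop) I : I != ideal0 -> P I ->
  exists J, [/\ {subset I <= J}, P J &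
    forall K, {subset J <= K} -> P K -> K = J].
Proof.
have [k] := ubnP (ideal_norm I); elim: k I => // k IHk I ltIk I0 PI.
have [[K [IK PK neIK]]|H] :=
    pselect (exists K, [/\ {subset I <= K}, P K & K <> I]).
  have [||//|J [KJ PJ Jmax]] := IHk K.
  - rewrite -ltnS; apply: leq_trans ltIk; rewrite ltnS.
    by apply: ideal_norm_lt => // /esym.
  - exact: ideal_neq0_sub IK I0.
  by exists J; split=> // x /IK/KJ.
exists I; split=> // K IK PK; apply: contrapT => neIK.
by apply: H; exists K.
Qed.

Lemma prime_ideal_above I : I != ideal0 -> 1 \notin I ->
  exists2 p, prime_ideal p & {subset I <= p}.
Proof.
move=> I0 I1; have [p [Ip p1 pmax]] := ideal_maximal (P := fun J => 1 \notin J) I0 I1.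
exists p => //; split=> // u v puv; have [//|pu] := boolP (u \in p).
have : 1 \in idealD p (principal u).
  apply/negPn/negP => H; have E := pmax _ (@idealD_subl _ _ _) H.
  by move: pu; rewrite -E idealD_subr // mem_principal.
move=> /idealDP[q [_ [pq /principalP[c ->] e]]].
have -> : v = q * v + c * (u * v) by rewrite mulrA -mulrDl -e mul1r.
by apply: rpredD; [exact: ideal_mull|exact: ideal_mulr].
Qed.

(** The fraction x / b lies outside D but multiplies p into D. Among the ideals ((b) : x) contained
    in p, a maximal one Q is prime; it contains b, so it is a nonzero prime, hence a maximal ideal,
    and Q = p. *)
Lemma prime_colon p b : prime_ideal p -> p != ideal0 -> b \in p -> b != 0 ->
  exists2 x, x \notin principal b & forall y, y \in p -> x * y \in principal b.
Proof.
move=> pp p0 pb b0; have [p1 pP] := pp.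
pose P J := exists2 x, J = colon (principal b) x & {subset J <= p}.
have bI : principal b != ideal0.
  by apply/ideal_neq0P; exists b; rewrite ?mem_principal.
have [|Q [bQ [x Qx Qp] Qmax]] := @ideal_maximal P (principal b) bI.
  exists 1; last exact/principal_sub.
  by apply/ideal_eqP => y; rewrite in_colon mulr1.
have Qprime : prime_ideal Q.
  split=> [|u v Quv]; first by apply: contra p1; exact: Qp.
  apply/orP; have [?|/negP Qv] := boolP (v \in Q); [by right|left].
  have [vp|] := pselect {subset colon (principal b) (v * x) <= p}.
    rewrite -(Qmax (colon (principal b) (v * x))); last by exists (v * x).
      by move: Quv; rewrite Qx !in_colon mulrA.
    by move=> y; rewrite Qx !in_colon mulrCA; exact: ideal_mulr.
  (* With s outside the prime p, ((b) : s x) stays inside p, so it equals Q by maximality; but it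
     contains v. *)
  move=> vp; have [s sb ps] : exists2 s, s \in colon (principal b) (v * x) & s \notin p.
    by apply: contrapT => H; apply: vp => s sb; apply/negPn/negP => ps; apply: H; exists s.
  case: Qv; rewrite -(Qmax (colon (principal b) (s * x))).
  - by move: sb; rewrite !in_colon mulrCA.
  - by move=> y; rewrite Qx !in_colon mulrCA; exact: ideal_mulr.
  - exists (s * x) => // t; rewrite in_colon mulrA -in_colon -Qx => /Qp/pP.
    by rewrite (negbTE ps) orbF.
have Q0 : Q != ideal0 := ideal_neq0_sub bQ bI.
have [_ Qm] := dedekind_prime_maximal D_dedekind Qprime Q0.
have pQ : p = Q by case: (Qm p Qp) => // e; move: p1; rewrite e.
exists x => [|y]; last by rewrite pQ Qx in_colon mulrC.
by apply: contra p1 => xb; apply: Qp; rewrite Qx in_colon mul1r.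
Qed.

(* For I maximal among the non-invertible ideals, take x outside (b) with
   x * I inside (b): either I + (x/b) I = I, and then x/b is integral, or
   this larger ideal is invertible, and then so is I. *)
Theorem dedekind_invertible I : I != ideal0 -> invertible I.
Proof.
move=> I'0; apply: contrapT => nI'.
have [J [I'J nJ Jmax]] := ideal_maximal (P := fun J => ~ invertible J) I'0 nI'.
have J0 := ideal_neq0_sub I'J I'0.
have J1 : 1 \notin J.
  apply/negP => /ideal1P E; apply: nJ; exists ideal1, 1.
  rewrite oner_neq0 E idealM1; split=> //; apply/esym/ideal1P.
  exact: mem_principal.
have [p pp Jp] := prime_ideal_above J0 J1.
have p0 := ideal_neq0_sub Jp J0; have [b b0 pb] := ideal_neq0P _ p0.
have [x xb px] := prime_colon pp p0 pb b0.
pose B := principal b; pose X := idealD B (principal x).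
pose K := colon (idealM J X) b.
have bK : idealM B K = idealM J X.
  apply: ideal_anti => [y /mem_principalM[z Kz ->]|].
    by rewrite mulrC -in_colon.
  rewrite idealMDr; apply: idealD_sub; apply: idealM_sub => y _ Jy /principalP[c ->].
    rewrite (_ : y * (c * b) = b * (y * c)); last by rewrite mulrA mulrC.
    rewrite mem_idealM ?mem_principal // in_colon.
    by apply: mem_idealM; [exact: ideal_mull|apply/idealD_subl/mem_principal].
  have /principalP[e xy] := px _ (Jp _ Jy).
  have E : y * (c * x) = c * e * b by rewrite mulrCA [y * x]mulrC xy mulrA.
  rewrite E mulrC mem_idealM ?mem_principal // in_colon -E mem_idealM //.
  by apply/idealD_subr/principalP; exists c.
have JK : {subset J <= K}.
  by move=> y Jy; rewrite in_colon mem_idealM // idealD_subl ?mem_principal.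
have [[K' [c [c0 cK]]]|nK] := pselect (invertible K); last first.
  have KJ : K = J by exact: Jmax.
  move: xb; apply/negP/negPn; apply: (dvd_of_stable J0 b0) => y Jy.
  apply: mem_principalM; rewrite -/B -{1}KJ bK mulrC.
  by rewrite mem_idealM // idealD_subr ?mem_principal.
apply: nJ; exists (idealM X K'), (b * c); rewrite mulf_neq0 //; split=> //.
by rewrite idealMA -bK -idealMA cK principalM.
Qed.

Lemma idealM_inj I J K : I != ideal0 -> idealM I J = idealM I K -> J = K.
Proof. by move/dedekind_invertible; exact: invertible_inj. Qed.

Lemma dvd_idealP I J : I != ideal0 -> dvd_ideal I J <-> {subset J <= I}.
Proof.
move=> I0; split=> [[K ->]|]; first exact: idealM_subl.
exact/invertible_dvd/dedekind_invertible.
Qed.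

(** Write n = g k with g = n + (b). Then g (n : b) lies in n = g k, and cancelling g puts (n : b)
    inside k; conversely b k lies in g k = n. *)
Lemma colonM n b : n != ideal0 ->
  idealM (idealD n (principal b)) (colon n b) = n.
Proof.
move=> n0; set g := idealD n _.
have g0 : g != ideal0 by apply: ideal_neq0_sub n0; exact: idealD_subl.
have [k nk] : dvd_ideal g n by apply/dvd_idealP => //; exact: idealD_subl.
suff -> : colon n b = k by [].
apply: ideal_anti.
  apply: (invertible_sub (dedekind_invertible g0)); rewrite -nk.
  apply: idealM_sub => x y /idealDP[u [_ [nu /principalP[c ->] ->]]] yb.
  rewrite mulrDl; apply: rpredD; first exact: ideal_mull.
  by rewrite -mulrA [b * y]mulrC; exact: ideal_mulr.
move=> y ky; rewrite in_colon nk mulrC mem_idealM //.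
by apply: idealD_subr; exact: mem_principal.
Qed.

(** Induction on the norm of n = m m'. Choose b in m' outside n and write n + (b) = m' l; then m = l
    (n : b). The induction hypothesis applies to both factorizations, and [ideal_norm_colon]
    combines them. *)
Lemma ideal_normM m m' : idealM m m' != ideal0 ->
  ideal_norm (idealM m m') = (ideal_norm m * ideal_norm m')%N.
Proof.
have [k] := ubnP (ideal_norm (idealM m m')).
elim: k m m' => // k IHk m m' ltk n0; set n := idealM m m' in ltk n0 *.
have m0 : m != ideal0 := idealM_neq0l n0.
have m'0 : m' != ideal0 := idealM_neq0r n0.
have [m1|m1] := eqVneq m ideal1.
  by rewrite /n m1 idealMC idealM1 ideal_norm1 // mul1n.
have [m'1|m'1] := eqVneq m' ideal1.
  by rewrite /n m'1 idealM1 ideal_norm1 // muln1.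
have nm' : n <> m'.
  move=> e; move/eqP: m1; apply; apply: (idealM_inj m'0).
  by rewrite idealMC -/n e idealM1.
have nm : n <> m.
  by move=> e; move/eqP: m'1; apply; apply: (idealM_inj m0); rewrite idealM1.
have [b m'b nb] : exists2 b, b \in m' & b \notin n.
  apply: contrapT => H; apply: nm'; apply: ideal_anti; first exact: idealM_subr.
  by move=> b m'b; apply/negPn/negP => nb; apply: H; exists b.
pose g := idealD n (principal b).
have ng : {subset n <= g} by exact: idealD_subl.
have g0 : g != ideal0 := ideal_neq0_sub ng n0.
have [l gl] : dvd_ideal m' g.
  apply/dvd_idealP => //; apply: idealD_sub; first exact: idealM_subr.
  exact/principal_sub.
have lc : m = idealM l (colon n b).
  by apply: (idealM_inj m'0); rewrite idealMA -gl colonM // idealMC.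
have ltg : (ideal_norm g < ideal_norm n)%N.
  apply: ideal_norm_lt => // e; move: nb; rewrite e.
  by rewrite idealD_subr ?mem_principal.
have ltm : (ideal_norm m < ideal_norm n)%N.
  by apply: ideal_norm_lt => //; exact: idealM_subl.
rewrite (ideal_norm_colon D_resfin b n0) -/g gl IHk -?gl //; last first.
  by rewrite -ltnS; exact: leq_trans ltk.
rewrite [in RHS]lc IHk -?lc //; last by rewrite -ltnS; exact: leq_trans ltk.
by rewrite mulnCA mulnC; congr (_ * _)%N; exact: mulnC.
Qed.

End Dedekind.

(** * The series of n_0, the radical and the order of a *)

Section NuSeries.
Variable D : idomainType.
Hypothesis D_dedekind : dedekind_domain D.
Hypothesis D_resfin : residually_finite D.
Implicit Types (I J K n m : ideal D) (a b x y : D).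

Lemma ideal_div_eq n m k : m != ideal0 -> n = idealM m k -> ideal_div n m = k.
Proof.
move=> m0 nk; apply: xget_unique => //= k' nk'.
by apply: (idealM_inj D_dedekind D_resfin m0); rewrite -nk' -nk.
Qed.

Lemma ideal_divE n m a : n != ideal0 -> m = idealD n (principal a) ->
  ideal_div n m = colon n a.
Proof.
move=> n0 ->; apply: ideal_div_eq; last by rewrite colonM.
by apply: ideal_neq0_sub n0; exact: idealD_subl.
Qed.

(** The product telescopes: n + (a^i) times (n : a^i) is n by [colonM], and times (a) it is a n +
    (a^(i+1)). *)
Lemma nu_prodE n a i : n != ideal0 ->
  nu_prod n a i = idealD n (principal (a ^+ i)).
Proof.
move=> n0; elim: i => [|i IHi].
  by apply/esym/ideal1P/idealD_subr; rewrite expr0 mem_principal.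
rewrite /= (ideal_divE n0 IHi) IHi idealMDr colonM //.
apply: ideal_anti.
  apply: idealD_sub; first exact: idealD_subl.
  rewrite idealMC idealMDr principalM -exprS; apply: idealD_sub; last exact: idealD_subr.
  by move=> x /idealM_subr; exact: idealD_subl.
apply: idealD_sub; first exact: idealD_subl.
move=> x ax; apply: idealD_subr; rewrite idealMC idealMDr principalM -exprS.
exact: idealD_subr.
Qed.

Lemma nu_idealE n a i : n != ideal0 ->
  nu_ideal n a i = idealD (colon n (a ^+ i)) (principal a).
Proof. by move=> n0; rewrite /nu_ideal (ideal_divE n0 (nu_prodE _ _ n0)). Qed.

(** Writing 1 = u + v with u in (a) and v in n1, the part v y moves from (n0 : x) into (n0 n1 : x),
    and u y lies in (a). This carries the fibre counts of D/n over to the series of n0. *)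
Lemma coprime_colon n0 n1 a x : idealD (principal a) n1 = ideal1 ->
  idealD (colon n0 x) (principal a) =
  idealD (colon (idealM n0 n1) x) (principal a).
Proof.
move=> co; have /idealDP[u [v [au n1v e]]] : 1 \in idealD (principal a) n1.
  by rewrite co.
apply: ideal_anti; apply: idealD_sub; try exact: idealD_subr.
  move=> y n0y; have -> : y = v * y + u * y by rewrite -mulrDl addrC -e mul1r.
  apply/idealDP; exists (v * y), (u * y); split=> //; last exact: ideal_mull.
  by rewrite in_colon -mulrA mulrC mem_idealM.
by move=> y ny; apply: idealD_subl; rewrite in_colon; apply: idealM_subl ny.
Qed.

Lemma finite_ideals_above n : n != ideal0 ->
  finite_set [set I : ideal D | {subset n <= I}]%classic.
Proof.
move=> n0; have fin := D_resfin n0.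
pose F (S : {set fquot fin}) := xget ideal1
  [set I : ideal D | {subset n <= I} /\ forall x, (x \in I) = (proj fin x \in S)]%classic.
apply: (@sub_finite_set _ _ (F @` setT)%classic); last first.
  by apply: finite_image; exact: finite_finset.
move=> I nI; exists (finset (fun u : fquot fin => lift_proj u \in I)) => //.
have IE x : (x \in I) = (proj fin x \in finset (fun u : fquot fin => lift_proj u \in I)).
  rewrite inE; have xl := nI _ (lift_proj_proj fin x).
  by rewrite -[x in LHS](subrK (lift_proj (proj fin x))) rpredDl.
apply: xget_unique => //= J [_ JE]; apply: ideal_anti => x; by rewrite JE IE.
Qed.

Lemma big_idealM_sub (s : seq (ideal D)) p :
  p \in s -> {subset \big[@idealM D/ideal1]_(q <- s) q <= p}.
Proof.
elim: s => // q s IHs; rewrite inE big_cons => /predU1P[->|/IHs sp] x.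
  exact: idealM_subl.
by move/idealM_subr/sp.
Qed.

Lemma ideal_rad_sub n p : n != ideal0 -> prime_ideal p -> {subset n <= p} ->
  {subset ideal_rad n <= p}.
Proof.
move=> n0 pp np; apply: big_idealM_sub.
have dn : dvd_ideal p n.
  by apply/(dvd_idealP D_dedekind D_resfin) => //; exact: ideal_neq0_sub np n0.
(* Over an infinite support the iterated product would default to the unit ideal, so the prime
   divisors of n have to be finite in number. *)
rewrite in_finite_support.
  apply/mem_set; split=> //= e; case: pp => /negP p1 _.
  by apply: p1; rewrite e.
apply: sub_finite_set (finite_ideals_above n0) => q [[_ [k ->]] _] /=.
exact: idealM_subl.
Qed.

(** Otherwise an ideal containing n and maximal among those that miss every power of a would be
    prime; it would contain the radical of n, hence a. *)
Lemma rad_nilpotent n a : n != ideal0 -> {subset principal a <= ideal_rad n} ->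
  exists e, a ^+ e \in n.
Proof.
move=> n0 an; apply: contrapT => H.
have [|p [np pa pmax]] :=
    @ideal_maximal _ D_resfin (fun J => forall e, a ^+ e \notin J) n n0.
  by move=> e; apply/negP => ae; apply: H; exists e.
have pp : prime_ideal p.
  split=> [|u v puv]; first by have := pa 0%N; rewrite expr0.
  have outside w : w \notin p -> exists e, a ^+ e \in idealD p (principal w).
    move=> pw; apply: contrapT => Hw; move: pw; rewrite -(pmax (idealD p (principal w))).
    - by rewrite idealD_subr ?mem_principal.
    - exact: idealD_subl.
    - by move=> e; apply/negP => ?; apply: Hw; exists e.
  apply/negPn/negP; rewrite negb_or => /andP[/outside[e ae] /outside[f af]].
  suff : a ^+ (e + f) \in p by apply/negP.
  rewrite exprD; case/idealDP: ae => [x [_ [px /principalP[c ->] ->]]].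
  case/idealDP: af => [y [_ [py /principalP[c' ->] ->]]].
  rewrite mulrDl; apply: rpredD; first exact: ideal_mull.
  rewrite mulrDr; apply: rpredD; first exact: ideal_mulr.
  by rewrite mulrACA ideal_mulr.
suff : a ^+ 1 \in p by apply/negP.
by rewrite expr1 (ideal_rad_sub n0 pp np) // an ?mem_principal.
Qed.

Lemma leastP (P : pred nat) : (exists i, P i) ->
  P (least P) /\ forall i, P i -> (least P <= i)%N.
Proof.
rewrite /least; case: pselect => // exP _.
by case: ex_minnP => i Pi imin.
Qed.

Definition nu_length n a : nat := least (fun d => (0 < d)%N && (nu_prod n a d == n)).

Lemma size_nu_series n a : size (nu_series n a) = nu_length n a.
Proof. by rewrite size_map size_iota. Qed.

Lemma nu_lengthP n a : n != ideal0 -> {subset principal a <= ideal_rad n} ->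
  (0 < nu_length n a)%N /\ a ^+ nu_length n a \in n.
Proof.
move=> n0 /(rad_nilpotent n0)[e ae].
have [|/andP[d0 /eqP nd] _] := @leastP (fun d => (0 < d)%N && (nu_prod n a d == n)).
  (* The index must be positive, whereas e can be 0 when n is the unit ideal. *)
  exists e.+1; rewrite /= -/(nu_prod n a e.+1) nu_prodE //; apply/eqP.
  apply: ideal_anti; last exact: idealD_subl.
  by apply: idealD_sub => //; apply/principal_sub; rewrite exprS ideal_mulr.
split=> //; suff : a ^+ nu_length n a \in nu_prod n a (nu_length n a) by rewrite nd.
by rewrite nu_prodE // idealD_subr ?mem_principal.
Qed.

Lemma nu_nu_series n a i : (i < nu_length n a)%N ->
  nu (nu_series n a) i.+1 = ideal_norm (nu_ideal n a i).
Proof. by move=> li; rewrite /nu (nth_map 0%N) ?size_iota // nth_iota. Qed.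

Lemma coprime_pow m a k : idealD (principal a) m = ideal1 ->
  idealD (principal (a ^+ k)) m = ideal1.
Proof.
move=> co; have /idealDP[_ [v [/principalP[c ->] mv e]]] : 1 \in idealD (principal a) m.
  by rewrite co.
apply: ideal1P; elim: k => [|k IHk].
  by apply: idealD_subl; rewrite expr0 mem_principal.
move: IHk => /idealDP[_ [w [/principalP[b ->] mw e']]].
apply/idealDP; exists (c * b * a ^+ k.+1), (c * a * w + v); split.
- by apply/principalP; eexists.
- by apply: rpredD => //; exact: ideal_mulr.
- by rewrite addrA exprS mulrACA -mulrDr -e' mulr1.
Qed.

Lemma coprime_cancel m a x : idealD (principal a) m = ideal1 ->
  a * x \in m -> x \in m.
Proof.
move=> co ax; have /idealDP[_ [v [/principalP[c ->] mv e]]] : 1 \in idealD (principal a) m.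
  by rewrite co.
rewrite -[x]mul1r e mulrDl; apply: rpredD; last exact: ideal_mull.
by rewrite -mulrA ideal_mulr.
Qed.

(** Multiplication by a permutes the finite ring D/m, so the orbit of 1 closes up at 1. The case m =
    D is included, with order 1. *)
Lemma ideal_orderP m a : m != ideal0 -> idealD (principal a) m = ideal1 ->
  [/\ (0 < ideal_order a m)%N, a ^+ ideal_order a m - 1 \in m &
    forall i, (0 < i < ideal_order a m)%N -> a ^+ i - 1 \notin m].
Proof.
move=> m0 co; have fin := D_resfin m0.
pose g (u : fquot fin) := proj fin a * u.
have gI : injective g.
  move=> u v; rewrite -[u]lift_projK -[v]lift_projK /g -!projM => /projP.
  by rewrite -mulrBr => /(coprime_cancel co)/projP.
have gE k : iter k g (proj fin 1) = proj fin (a ^+ k).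
  by elim: k => //= k ->; rewrite /g exprS projM.
have [|/andP[o0 oP] omin] := @leastP (fun i => (0 < i)%N && (a ^+ i - 1 \in m)).
  exists (fingraph.order g (proj fin 1)); rewrite order_gt0 -(proj_eq fin).
  by rewrite -gE iter_order ?eqxx.
split=> // i /andP[i0 lti]; apply/negP => ai.
by have := omin i; rewrite i0 ai leqNgt lti => /(_ isT).
Qed.

End NuSeries.

(** * Annihilators, and multiplication by a on D/n *)

Section Annihilator.
Variables (D : idomainType) (n : ideal D) (fin : finite_set [set: idquot n]).

Definition ann (u : fquot fin) : ideal D := colon n (lift_proj u).

Lemma in_ann c u : (c \in ann u) = (proj fin c * u == 0).
Proof. by rewrite in_colon -[u in RHS]lift_projK -projM proj_eq0. Qed.

Lemma sub_ann u : {subset n <= ann u}.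
Proof. exact: sub_colon. Qed.

Lemma ann_neq0 u : n != ideal0 -> ann u != ideal0.
Proof. exact: ideal_neq0_sub (@sub_ann u). Qed.

End Annihilator.

Section Multiplication.
Variable D : idomainType.
Hypothesis D_dedekind : dedekind_domain D.
Hypothesis D_resfin : residually_finite D.
Variables (a : D) (n : ideal D).
Hypothesis n_neq0 : n != ideal0.
Let fin := D_resfin n_neq0.
Local Notation X := (fquot fin).
Let f (u : X) : X := proj fin a * u.

Lemma iter_mulE k u : iter k f u = proj fin (a ^+ k) * u.
Proof.
elim: k => [|k IHk] /=; last by rewrite IHk /f mulrA -projM exprS.
by rewrite expr0 -[u in LHS]lift_projK -[u in RHS]lift_projK -projM mul1r.
Qed.

Lemma mulD u v : f (u + v) = f u + f v.
Proof. exact: mulrDr. Qed.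

Lemma mulB u v : f (u - v) = f u - f v.
Proof. exact: mulrBr. Qed.

Lemma in_imageB i u v : in_image f i u -> in_image f i v -> in_image f i (u - v).
Proof.
move=> /in_imageP[u' <-] /in_imageP[v' <-]; apply/in_imageP; exists (u' - v').
by rewrite !iter_mulE mulrBr.
Qed.

Lemma in_imageD i u v : in_image f i u -> in_image f i v -> in_image f i (u + v).
Proof.
move=> /in_imageP[u' <-] /in_imageP[v' <-]; apply/in_imageP; exists (u' + v').
by rewrite !iter_mulE mulrDr.
Qed.

(** Multiplication by a^i induces an injection of D/(n : a^i) into D/n whose image is I_i. *)
Lemma card_in_image i : #|[pred u | in_image f i u]| = ideal_norm (colon n (a ^+ i)).
Proof.
have finc := D_resfin (ideal_neq0_sub (@sub_colon _ n (a ^+ i)) n_neq0).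
rewrite (ideal_normE finc).
pose h (z : fquot finc) : X := proj fin (a ^+ i * lift_proj z).
have hI : injective h.
  move=> z z' /(projP fin); rewrite -mulrBr mulrC -in_colon => zz'.
  by rewrite -[z]lift_projK -[z']lift_projK; apply/(projP finc).
rewrite -(fintype.card_image hI); apply: eq_card => u; rewrite inE.
apply/in_imageP/fintype.imageP => [[v <-]|[z _ ->]]; last first.
  by exists (proj fin (lift_proj z)); rewrite iter_mulE -projM.
exists (proj finc (lift_proj v)) => //.
rewrite iter_mulE -[v in LHS]lift_projK -projM; apply/(projP fin).
by rewrite -mulrBr mulrC -in_colon lift_proj_proj.
Qed.

(** Translation by a point of the fibre lying in I_i carries the kernel within I_i onto the fibre
    within I_i. *)
Lemma card_fibre_ker i y : in_image f i.+1 y ->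
  #|[pred u | (f u == y) && in_image f i u]| =
  #|[pred u | (f u == 0) && in_image f i u]|.
Proof.
move=> /in_imageP[z]; rewrite iterS; set x0 := iter i f z => fx0.
have Ix0 : in_image f i x0 by apply/in_imageP; exists z.
rewrite -[RHS](fintype.card_image (addIr x0)); apply: eq_card => u; rewrite inE.
apply/idP/fintype.imageP => [/andP[/eqP fu Iu]|[v + ->]].
  exists (u - x0); last by rewrite subrK.
  by rewrite inE mulB fu fx0 subrr eqxx in_imageB.
by rewrite inE => /andP[/eqP fv Iv]; rewrite mulD fv add0r fx0 eqxx in_imageD.
Qed.

(** All fibres of I_i over I_(i+1) have the same size c, so N(n : a^i) = c N(n : a^(i+1)). Compare
    with [ideal_norm_colon] for the ideal (n : a^i) and the element a. *)
Lemma card_fibre_mul i y : in_image f i.+1 y ->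
  #|[pred u | (f u == y) && in_image f i u]| =
  ideal_norm (idealD (colon n (a ^+ i)) (principal a)).
Proof.
move=> /card_fibre_ker ->; set c := #|_|.
have c0 := ideal_neq0_sub (@sub_colon _ n (a ^+ i)) n_neq0.
have c0' := ideal_neq0_sub (@sub_colon _ n (a ^+ i.+1)) n_neq0.
apply/eqP; rewrite -(eqn_pmul2l (ideal_norm_gt0 D_resfin c0')) [in X in _ == X]exprS.
rewrite -colon_colon -ideal_norm_colon // -!card_in_image -[in X in _ == X]sum1_card.
rewrite (partition_big f [pred y | in_image f i.+1 y]) /=; last first.
  by move=> u; exact: in_imageS.
rewrite (eq_bigr (fun=> c)) => [|y' Iy']; first by rewrite sum_nat_const.
rewrite sum1_card /c -(card_fibre_ker Iy').
by apply: eq_card => u; rewrite !inE andbC.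
Qed.

Lemma iter_mul_fix i u : (iter i f u == u) = (a ^+ i - 1 \in ann u).
Proof.
rewrite iter_mulE -{1 2}[u]lift_projK -projM proj_eq in_colon.
by rewrite mulrBl mul1r.
Qed.

Lemma ann_mul u : idealD (principal a) (ann u) = ideal1 -> ann (f u) = ann u.
Proof.
have E c : (c \in ann (f u)) = (c * a \in ann u) by rewrite !in_ann projM -mulrA.
move=> co; apply: ideal_anti => c; rewrite E; last exact: ideal_mull.
by rewrite mulrC; exact: coprime_cancel.
Qed.

Lemma ann_cyclic m : idealD (principal a) m = ideal1 ->
  cyclic_on f (ideal_order a m) [pred u | ann u == m].
Proof.
move=> co u /eqP um; have m0 : m != ideal0 by rewrite -um ann_neq0.
have [o0 oP omin] := ideal_orderP D_resfin m0 co.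
split=> [||i /omin]; first by rewrite /= ann_mul um.
  by apply/eqP; rewrite iter_mul_fix um.
by rewrite -um -iter_mul_fix => /eqP.
Qed.

(** From 1 = c a^d + v with v killing u comes u = a^d (c u). *)
Lemma in_image_ann d u : idealD (principal a) (ann u) = ideal1 -> in_image f d u.
Proof.
move=> /(coprime_pow d) co; apply/in_imageP.
have /idealDP[_ [v [/principalP[c ->] uv e]]] : 1 \in idealD (principal (a ^+ d)) (ann u).
  by rewrite co.
exists (proj fin c * u); rewrite iter_mulE mulrA -projM mulrC.
apply/eqP; rewrite -subr_eq0; move: uv; rewrite in_ann => /eqP uv.
have {2}-> : u = proj fin 1 * u.
  by rewrite -[u in RHS]lift_projK -projM mul1r lift_projK.
rewrite e projD mulrDl uv addr0 [c * _]mulrC [X in X - _]mulrC subrr //.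
Qed.

End Multiplication.

(** * Counting the elements with a given annihilator *)

Lemma card_in_seq (T : finType) (I : eqType) (g : T -> I) (L : seq I) :
  uniq L -> #|[pred u | g u \in L]| = \sum_(k <- L) #|[pred u | g u == k]|.
Proof.
elim: L => [|k L IHL] /=; first by rewrite big_nil eq_card0.
case/andP=> kL /IHL IH; rewrite big_cons -IH.
rewrite -(cardID [pred u | g u == k]); congr (_ + _)%N; apply: eq_card => u;
  by rewrite !inE; have [->|] := eqVneq (g u) k; rewrite ?(negbTE kL) ?andbF.
Qed.

Section AnnihilatorCount.
Variable D : idomainType.
Hypothesis D_dedekind : dedekind_domain D.
Hypothesis D_resfin : residually_finite D.
Implicit Types (n m : ideal D).

(** If n = m m', then m kills u exactly when u lies in m'/n, by cancelling m; this set has N(n) /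
    N(m') = N(m) elements. *)
Lemma card_killed n m (fin : finite_set [set: idquot n]) : n != ideal0 ->
  {subset n <= m} ->
  #|[pred u : fquot fin | `[< {subset m <= ann u} >]]| = ideal_norm m.
Proof.
move=> n0 nm; have m0 := ideal_neq0_sub nm n0.
have [m' nE] : dvd_ideal m n by apply/(dvd_idealP D_dedekind D_resfin).
have m'0 : m' != ideal0 by move: n0; rewrite nE; exact: idealM_neq0r.
have nm' : {subset n <= m'} by rewrite nE; exact: idealM_subr.
have E := ideal_norm_card D_resfin fin n0 nm'.
have E' : ideal_norm n = (ideal_norm m * ideal_norm m')%N.
  by rewrite {1}nE ideal_normM // -nE.
apply/eqP; rewrite -(eqn_pmul2r (ideal_norm_gt0 D_resfin m'0)) -E' E.
apply/eqP; congr (_ * _)%N; apply: eq_card => u; rewrite !inE.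
apply/asboolP/idP => [mu|m'u x mx]; last first.
  by rewrite in_colon; have := mem_idealM mx m'u; rewrite -nE.
suff : {subset principal (lift_proj u) <= m'} by move/principal_sub.
apply: (invertible_sub (dedekind_invertible D_dedekind D_resfin m0)).
rewrite -nE; apply: idealM_sub => x _ mx /principalP[c ->].
by rewrite mulrCA ideal_mulr // -in_colon; exact: mu.
Qed.

(* Both sides satisfy the same recursion over the ideals containing m, as
   the elements killed by m are counted by the norm of m in either ring. *)
Lemma card_ann_indep n m (finn : finite_set [set: idquot n])
    (finm : finite_set [set: idquot m]) : n != ideal0 -> {subset n <= m} ->
  #|[pred u : fquot finn | ann u == m]| = #|[pred u : fquot finm | ann u == m]|.
Proof.
have [k] := ubnP (ideal_norm m); elim: k m n finn finm => // k IHk m n finn finm.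
rewrite ltnS => lek n0 nm; have m0 := ideal_neq0_sub nm n0.
pose Q (I : ideal D) := `[< {subset m <= I} >] && (I != m).
(* The ideals strictly above m that are annihilators in either ring, so that both recursions sum
   over one list. *)
pose L := undup (seq.filter Q (map (@ann _ _ finn) (enum {: fquot finn}) ++
                           map (@ann _ _ finm) (enum {: fquot finm}))).
have QL I : I \in L -> Q I by rewrite mem_undup mem_filter => /andP[].
have split_killed n' (fin' : finite_set [set: idquot n']) :
    n' != ideal0 -> {subset n' <= m} ->
    (forall u : fquot fin', Q (ann u) -> ann u \in L) ->
    ideal_norm m = (#|[pred u : fquot fin' | ann u == m]|
                    + \sum_(I <- L) #|[pred u : fquot fin' | ann u == I]|)%N.
  move=> n'0 n'm inL; rewrite -(card_killed fin' n'0 n'm) -card_in_seq ?undup_uniq //.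
  rewrite -(cardID [pred u | ann u == m]); congr (_ + _)%N; apply: eq_card => u.
    rewrite !inE andbC; apply/andb_idr => /eqP ->; exact/asboolP.
  rewrite !inE andbC; apply/idP/idP => [|/QL//]; exact: inL.
have En := split_killed n finn n0 nm _; have Em := split_killed m finm m0 (fun=> id) _.
apply: (@addIn (\sum_(I <- L) #|[pred u : fquot finn | ann u == I]|)).
rewrite -En => [|u Qu]; last first.
  by rewrite mem_undup mem_filter Qu mem_cat map_f ?mem_enum.
rewrite Em => [|u Qu]; last first.
  by rewrite mem_undup mem_filter Qu mem_cat [X in _ || X]map_f ?mem_enum // orbT.
congr (_ + _)%N; apply: eq_big_seq => I /QL/andP[/asboolP mI Im].
have I0 := ideal_neq0_sub mI m0.
have ltI : (ideal_norm I < k)%N.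
  apply: leq_trans lek; apply: (ideal_norm_lt D_resfin m0 mI).
  by move=> e; rewrite e eqxx in Im.
(* Both counts for I are compared with the count in D/I. *)
rewrite (IHk I m finm (D_resfin I0)) // (IHk I n finn (D_resfin I0)) //.
by move=> x /nm/mI.
Qed.

(** In D/m, annihilator m means that multiplication by u is injective, hence bijective on a finite
    ring, so u is a unit. For m = D the single element of the zero ring matches the convention for
    phi. *)
Lemma card_ann_self m (fin : finite_set [set: idquot m]) : m != ideal0 ->
  #|[pred u : fquot fin | ann u == m]| = ideal_phi m.
Proof.
move=> m0; rewrite /ideal_phi; case: eqVneq => [m1|m1].
  have <- : ideal_norm m = 1%N by rewrite m1 ideal_norm1.
  rewrite (ideal_normE fin); apply: eq_card => u; rewrite !inE.
  by apply/eqP/ideal_anti => [x _|]; [rewrite m1|exact: sub_ann].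
rewrite (ncardE fin); apply: eq_card => u; rewrite !inE.
apply/eqP/idP => [um|/set_mem[v vu]].
  have uI : injective (fun v : fquot fin => v * u).
    move=> v w /= e; have : lift_proj v - lift_proj w \in ann u.
      by rewrite in_ann projB !lift_projK mulrBl e subrr.
    by rewrite um => /(projP fin); rewrite !lift_projK.
  have [h hK Kh] := injF_bij uI; apply/mem_set; exists (h 1).
  exact: Kh.
apply: ideal_anti; last exact: sub_ann.
move=> c; rewrite in_ann => /eqP cu; rewrite -(proj_eq0 fin).
have vu' : (v : fquot fin) * u = 1 := vu.
by rewrite -[proj _ _]mulr1 -vu' mulrCA cu mulr0.
Qed.

End AnnihilatorCount.

Theorem theorem3p6 (D : idomainType) (D_dedekind : dedekind_domain D)
    (D_resfin : residually_finite D) (a : D) (a_neq0 : a != 0)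
    (n n0 n1 : ideal D) (n_neq0 : n != ideal0)
    (n_dec : a_decomposition a n n0 n1) :
  graph_iso
    (functional_graph (@Gamma D a n))
    (gsum (fun m : {m : ideal D | dvd_ideal m n1} =>
       gcopies (ideal_phi (sval m) %/ ideal_order a (sval m))
         (Cyc (ideal_order a (sval m)) (elem_tree (nu_series n0 a))))).
Proof.
have [nE an0 co] := n_dec.
have n0_neq0 : n0 != ideal0 by move: n_neq0; rewrite nE; exact: idealM_neq0l.
have n1_neq0 : n1 != ideal0 by move: n_neq0; rewrite nE; exact: idealM_neq0r.
have [d_gt0 and0] := nu_lengthP D_dedekind D_resfin n0_neq0 an0.
set d := nu_length n0 a in d_gt0 and0.
have dvd_neq0 m : dvd_ideal m n1 -> m != ideal0.
  by move=> [k n1E]; move: n1_neq0; rewrite n1E; exact: idealM_neq0l.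
have dvd_sub m : dvd_ideal m n1 -> {subset n1 <= m}.
  by move=> [k ->]; exact: idealM_subl.
have dvd_co m : dvd_ideal m n1 -> idealD (principal a) m = ideal1.
  move=> /dvd_sub n1m; apply: ideal1P; have : 1 \in idealD (principal a) n1 by rewrite co.
  by apply: idealD_sub; [exact: idealD_subl|move=> x /n1m; exact: idealD_subr].
pose fin := D_resfin n n_neq0.
(* Convertible to [Gamma], but on a type with a [finType] structure. *)
pose f (u : fquot fin) : fquot fin := proj fin a * u.
have fibre i y : in_image f i.+1 y ->
    #|[pred u | (f u == y) && in_image f i u]| =
    ideal_norm (idealD (colon n0 (a ^+ i)) (principal a)).
  move=> Iy; rewrite (coprime_colon _ _ co) -nE.
  exact: (card_fibre_mul Iy).
(* As a^d lies in n0, n1 kills every element of I_d; conversely a is coprime to each divisor of n1,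
   and [in_image_ann] applies. *)
have ann_dvd u : in_image f d u <-> exists m : {m : ideal D | dvd_ideal m n1}, ann u == sval m.
  split=> [/in_imageP[v <-]|[[m mn1] /= /eqP um]]; last first.
    by apply: in_image_ann; rewrite um dvd_co.
  set w := iter d f v.
  suff wn1 : dvd_ideal (ann w) n1 by exists (exist _ (ann w) wn1); rewrite /= eqxx.
  apply/(dvd_idealP D_dedekind D_resfin); first exact: ann_neq0.
  move=> c n1c; rewrite in_ann /w iter_mulE mulrA -projM.
  rewrite (_ : proj fin _ = 0) ?mul0r //; apply/eqP; rewrite proj_eq0 mulrC.
  by have := mem_idealM and0 n1c; rewrite -nE.
have phiE (m : {m : ideal D | dvd_ideal m n1}) :
    #|[pred u : fquot fin | ann u == sval m]| = ideal_phi (sval m).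
  case: m => m mn1 /=; have m0 := dvd_neq0 _ mn1.
  rewrite (card_ann_indep D_dedekind D_resfin fin (D_resfin _ m0)) //.
    exact: card_ann_self.
  by rewrite nE => x /idealM_subr; exact: dvd_sub.
have -> : (fun m : {m : ideal D | dvd_ideal m n1} =>
      gcopies (ideal_phi (sval m) %/ ideal_order a (sval m))
        (Cyc (ideal_order a (sval m)) (elem_tree (nu_series n0 a)))) =
    (fun m => gcopies (#|[pred u : fquot fin | ann u == sval m]|
                       %/ ideal_order a (sval m))
        (Cyc (ideal_order a (sval m)) (elem_tree (nu_series n0 a)))).
  by apply: funext => m; rewrite phiE.
apply: (@functional_graph_iso _ f (nu_series n0 a) _
  (fun m : {m : ideal D | dvd_ideal m n1} => [pred u | ann u == sval m])
  (fun m => ideal_order a (sval m))); rewrite ?size_nu_series -/d //.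
- move=> i y ltid Iy; rewrite fibre // nu_nu_series // nu_idealE //.
(* Coprimality puts y in I_(d+1), not only in I_d, so [fibre] applies with i = d; the norm is then 1
   because (n0 : a^d) is the unit ideal. *)
- move=> y /ann_dvd[[m mn1] /= /eqP ym]; rewrite fibre; last first.
    by apply: in_image_ann; rewrite ym dvd_co.
  rewrite (_ : idealD _ _ = ideal1) ?ideal_norm1 //; apply: ideal1P.
  by apply: idealD_subl; rewrite in_colon mul1r.
- move=> [m mn1] [m' mn1'] u /= /eqP um /eqP um'; apply: eq_exist.
  by rewrite -um um'.
- by move=> [m mn1] /=; have [] := ideal_orderP D_resfin (dvd_neq0 _ mn1) (dvd_co _ mn1).
- by move=> [m mn1]; apply: ann_cyclic; exact: dvd_co.
Qed.
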